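(* Let $m\ge 1$ be a fixed integer and $a_1,\dots,a_m>0$ fixed constants with $\sum_{i=1}^m a_i=1$. For each $n$ let $P_n$ and $K_{1,n},\dots,K_{m,n}$ be positive integers with $1\le K_{i,n}\le P_n$, and consider the general random intersection graph $\mathbb{G}(n,\overrightarrow{a},\overrightarrow{K_n},P_n)$ described in the context. Suppose $P_n=\Omega(n)$ and $\omega(1)=K_{1,n}\le K_{2,n}\le\cdots\le K_{m,n}=o(\sqrt{P_n})$. Define \[ b_{1,n}=\sum_{j=1}^{m} a_j\left[1-\frac{\binom{P_n-K_{1,n}}{K_{j,n}}}{\binom{P_n}{K_{j,n}}}\right]. \] If there exists a sequence $\beta_n$ with $|\beta_n|=o(\ln n)$ such that $b_{1,n}=\frac{\ln n+\beta_n}{n}$ for all $n$, then \[ \lim_{n\to\infty}\mathbb{P}\big[\mathbb{G}(n,\overrightarrow{a},\overrightarrow{K_n},P_n)\text{ is connected}\big]=\begin{cases}0, & \text{if } \lim_{n\to\infty}\beta_n=-\infty,\\ 1, & \text{if } \lim_{n\to\infty}\beta_n=\infty.\end{cases} \]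
   Context: The graph $\mathbb{G}(n,\overrightarrow{a},\overrightarrow{K_n},P_n)$, with $\overrightarrow{a}=(a_1,\dots,a_m)$ and $\overrightarrow{K_n}=(K_{1,n},\dots,K_{m,n})$, is the random graph on vertex set $\{v_1,\dots,v_n\}$ constructed as follows. There is a pool of $P_n$ distinct objects. Each vertex independently is assigned to exactly one of $m$ groups $\mathcal{A}_1,\dots,\mathcal{A}_m$, with $\mathbb{P}[v\in\mathcal{A}_i]=a_i$. Then, independently, each vertex in group $\mathcal{A}_i$ chooses a set of $K_{i,n}$ objects uniformly at random among all $K_{i,n}$-element subsets of the pool. Two distinct vertices are joined by an undirected edge if and only if their object sets have at least one object in common. Asymptotic notation ($o,\Omega,\omega$) refers to $n\to\infty$; $\ln$ is the natural logarithm. *)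

(* Defs.v *)
From HB Require Import structures.
From mathcomp Require Import all_boot all_order all_algebra.
From mathcomp Require Import all_classical all_reals all_analysis.

Set Implicit Arguments.
Unset Strict Implicit.
Unset Printing Implicit Defensive.

Import Order.TTheory GRing.Theory Num.Theory.
Import numFieldNormedType.Exports.

Local Open Scope ring_scope.

(* [m] groups are indexed by ['I_m]; the pool of [P] objects is ['I_P]. *)
Section RandomIntersectionGraph.
Variables (R : realType) (m n P : nat).

(* An outcome records, for each of the [n] vertices, its group and the set of
   objects it chose. *)
Definition outcome : Type := {ffun 'I_n -> 'I_m * {set 'I_P}}.

(* Joint law of (group, object set) for one vertex: the group is [i] with
   probability [a i], and, given [i], the set is uniform among the [K i]-element
   subsets of the pool. *)
Definition vertex_law (a : 'I_m -> R) (K : 'I_m -> nat)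
    (x : 'I_m * {set 'I_P}) : R :=
  a x.1 * (if #|x.2| == K x.1 then ('C(P, K x.1)%:R)^-1 else 0).

(* The vertices are independent, so outcomes follow the product law. *)
Definition outcome_law (a : 'I_m -> R) (K : 'I_m -> nat) (w : outcome) : R :=
  \prod_(v : 'I_n) vertex_law a K (w v).

Definition Prob (a : 'I_m -> R) (K : 'I_m -> nat) (E : pred outcome) : R :=
  \sum_(w : outcome | E w) outcome_law a K w.

Definition adjacent (w : outcome) : rel 'I_n :=
  fun u v => (u != v) && ((w u).2 :&: (w v).2 != finset.set0).

Definition connected_graph (T : finType) (e : rel T) : bool :=
  [forall u, forall v, connect e u v].

Definition prob_connected (a : 'I_m -> R) (K : 'I_m -> nat) : R :=
  Prob a K (fun w => connected_graph (adjacent w)).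

Lemma vertex_law_sum1 (a : 'I_m -> R) (K : 'I_m -> nat) :
  \sum_i a i = 1 -> (forall i, (K i <= P)%N) ->
  \sum_x vertex_law a K x = 1.
Proof.
move=> a1 KP; rewrite -a1.
rewrite -(pair_big xpredT xpredT (fun i S => vertex_law a K (i, S))) /=.
apply: eq_bigr => i _; rewrite /vertex_law /= -mulr_sumr -big_mkcond /=.
rewrite sumr_const -[RHS]mulr1; congr (_ * _).
rewrite -cardsE card_draws card_ord -[_ *+ _]mulr_natr mulVf //.
by rewrite pnatr_eq0 -lt0n bin_gt0 KP.
Qed.

Lemma outcome_law_sum1 (a : 'I_m -> R) (K : 'I_m -> nat) :
  \sum_i a i = 1 -> (forall i, (K i <= P)%N) -> Prob a K xpredT = 1.
Proof.
move=> a1 KP; rewrite /Prob /outcome_law.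
rewrite -(bigA_distr_bigA (fun (_ : 'I_n) x => vertex_law a K x)) /=.
by rewrite big1 // => v _; exact: vertex_law_sum1.
Qed.

End RandomIntersectionGraph.

(* The probability that a vertex of group [i] is adjacent to another given
   vertex. *)
Definition edge_prob (R : realType) (m : nat) (a : 'I_m -> R) (K : 'I_m -> nat)
    (P : nat) (i : 'I_m) : R :=
  \sum_(j < m) a j * (1 - 'C(P - K i, K j)%:R / 'C(P, K j)%:R).

(* Main.v *)
(* beta -> -oo.  Let X count the isolated vertices of group 0; its mean is
   n a_0 (1 - b)^(n-1), about a_0 exp(- beta).  Two disjoint object sets of size
   K_0 are missed by a fresh vertex with probability at most
   sum_j a_j rho_j^2 <= 1 - 2 b + C b^2, where rho_j is the probability that a
   member of group j misses one of them.  Hence Var X = o((E X)^2), and Chebyshev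
   gives X > 0 with high probability.

   beta -> +oo.  A disconnected graph has a component S with 2 |S| <= n.  Write U
   for the union of the object sets of S, q(u) for the probability that a fresh
   vertex hits a given u-element set, a_max = a ord_max for the probability of
   the last group, and g = a_max / 64.
   - |S| = 1: the expected number is at most n exp(- (n - 1) b).
   - 2 <= |S| = r <= n^(1-g): as K_0 -> oo, |U| > (1 - g/8) r K_0 except with
     probability n^(-2r).  Explore S vertex by vertex: each new vertex hits the
     objects found so far, and no outside vertex hits U.  This has probability at
     most q^(r-1) exp(- (n - r) q) for a lower bound q of about (1 - g/4) r b on
     q(|U|), and the n^r orderings are beaten.
   - |S| > n^(1-g): condition on the groups.  With high probability the last group
     has at least n a_max / 4 members, and at least half of them lie in S or at
     least half outside S.  The absence of edges between these and the other side
     has probability at most exp(- c r ln n), which beats the number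
     (e n / r)^r <= (e n^g)^r of sets S. *)

Require Import Defs.
From HB Require Import structures.
From mathcomp Require Import all_boot all_order all_algebra.
From mathcomp Require Import ring lra zify.
From mathcomp Require Import all_classical all_reals all_analysis.
Import Order.TTheory GRing.Theory Num.Theory.
Import numFieldNormedType.Exports.
Local Open Scope ring_scope.

Set Implicit Arguments.
Unset Strict Implicit.
Unset Printing Implicit Defensive.

(** * Finite product laws *)

Section ProductLaw.
Variables (R : realFieldType) (V T : finType) (nu : V -> T -> R).
Implicit Types (w : {ffun V -> T}) (F G : {ffun V -> T} -> R).

(** The marginal [nu v] may vary with the coordinate, so the same calculus serves the unconditional
    law and the law given all groups. *)
Definition expect F : R := \sum_(w : {ffun V -> T}) (\prod_v nu v (w v)) * F w.

Definition upd w (v : V) (x : T) : {ffun V -> T} :=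
  [ffun u => if u == v then x else w u].

Lemma upd_id w v x : upd w v x v = x.
Proof. by rewrite ffunE eqxx. Qed.

Lemma upd_neq w v x u : u != v -> upd w v x u = w u.
Proof. by rewrite ffunE => /negPf ->. Qed.

Hypothesis nu_ge0 : forall v x, 0 <= nu v x.
Hypothesis nu_sum1 : forall v, \sum_x nu v x = 1.

Lemma weight_ge0 w : 0 <= \prod_v nu v (w v).
Proof. by apply: prodr_ge0 => v _. Qed.

(** The comparison is asked for on the support only, where every object set has the size prescribed
    by its group. *)
Lemma le_expect F G :
  (forall w, (forall v, nu v (w v) != 0) -> F w <= G w) ->
  expect F <= expect G.
Proof.
move=> FG; apply: ler_sum => w _.
have [/forallP w0|] := boolP [forall v, nu v (w v) != 0].
  by rewrite ler_wpM2l ?weight_ge0// FG.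
rewrite negb_forall => /existsP[v]; rewrite negbK => /eqP v0.
by rewrite (bigD1 v)//= v0 !mul0r.
Qed.

Lemma eq_expect F G : F =1 G -> expect F = expect G.
Proof. by move=> FG; apply: eq_bigr => w _; rewrite FG. Qed.

Lemma expectD F G : expect (fun w => F w + G w) = expect F + expect G.
Proof. by rewrite -big_split; apply: eq_bigr => w _ /=; rewrite mulrDr. Qed.

Lemma expectZ c F : expect (fun w => c * F w) = c * expect F.
Proof. by rewrite mulr_sumr; apply: eq_bigr => w _; rewrite mulrCA. Qed.

Lemma expect_sum (I : Type) (r : seq I) (Q : pred I) (F : I -> _ -> R) :
  expect (fun w => \sum_(i <- r | Q i) F i w) = \sum_(i <- r | Q i) expect (F i).
Proof.
rewrite /expect [RHS]exchange_big; apply: eq_bigr => w _; exact: mulr_sumr.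
Qed.

Lemma expect1 : expect (fun=> 1) = 1.
Proof.
rewrite /expect; under eq_bigr do rewrite mulr1.
by rewrite -(bigA_distr_bigA (fun v x => nu v x)) big1.
Qed.

Lemma expect_cst c : expect (fun=> c) = c.
Proof.
rewrite (_ : expect _ = expect (fun=> c * 1)); first by rewrite expectZ expect1 mulr1.
by apply: eq_expect => w; rewrite mulr1.
Qed.

Lemma expect_ge0 F : (forall w, 0 <= F w) -> 0 <= expect F.
Proof. by move=> F0; apply: sumr_ge0 => w _; rewrite mulr_ge0 ?weight_ge0. Qed.

(* The map (w, x) |-> (upd w v x, w v) is an involution that preserves the
   joint weight of an outcome and an independent fresh copy of coordinate v. *)
Lemma expect_resample v F :
  expect F = expect (fun w => \sum_x nu v x * F (upd w v x)).
Proof.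
pose h (p : {ffun V -> T} * T) := (upd p.1 v p.2, p.1 v).
have hK : involutive h.
  case=> w x; rewrite /h /= upd_id; congr pair; apply/ffunP => u.
  by rewrite !ffunE; case: eqP => // ->.
transitivity (\sum_(p : {ffun V -> T} * T)
    (\prod_u nu u (p.1 u)) * nu v p.2 * F p.1).
  rewrite -(pair_big xpredT xpredT
    (fun w x => (\prod_u nu u (w u)) * nu v x * F w)) /=.
  by apply: eq_bigr => w _; rewrite -mulr_suml -mulr_sumr nu_sum1 mulr1.
rewrite (reindex_inj (inv_inj hK)) /=.
rewrite -(pair_big xpredT xpredT
    (fun w x => (\prod_u nu u (upd w v x u)) * nu v (w v) * F (upd w v x))) /=.
apply: eq_bigr => w _; rewrite mulr_sumr; apply: eq_bigr => x _.
rewrite mulrA; congr (_ * _).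
rewrite (bigD1 v)//= [in RHS](bigD1 v)//= upd_id.
rewrite (eq_bigr (fun u => nu u (w u))); last by move=> u uv; rewrite upd_neq.
by ring.
Qed.

Lemma expect_coord v (f : T -> R) :
  expect (fun w => f (w v)) = \sum_x nu v x * f x.
Proof.
rewrite (expect_resample v) -[RHS]expect_cst; apply: eq_expect => w.
by apply: eq_bigr => x _; rewrite upd_id.
Qed.

(** Conditional independence: neither [F] nor the test function [h w] reads the coordinates in [s],
    so resampling these one at a time replaces each factor by its mean. In applications [h w]
    compares a fresh vertex with the objects of an already explored list. *)
Lemma expect_fresh (s : seq V) (F : {ffun V -> T} -> R)
    (h : {ffun V -> T} -> T -> R) :
  uniq s ->
  (forall w v x, v \in s -> F (upd w v x) = F w) ->
  (forall w v x, v \in s -> h (upd w v x) = h w) ->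
  expect (fun w => F w * \prod_(v <- s) h w (w v)) =
  expect (fun w => F w * \prod_(v <- s) \sum_x nu v x * h w x).
Proof.
elim: s F => [|v s IHs] F /=; first by move=> *; apply: eq_expect => w; rewrite !big_nil.
move=> /andP[vs us] Fv hv.
have hs w u x : u \in s -> h (upd w u x) = h w.
  by move=> us'; rewrite hv// inE us' orbT.
transitivity (expect (fun w => F w * h w (w v) * \prod_(u <- s) h w (w u))).
  by apply: eq_expect => w; rewrite big_cons mulrA.
rewrite (IHs (fun w => F w * h w (w v)))//; last first.
  move=> w u x us'; rewrite hs// Fv ?inE ?us' ?orbT// upd_neq//.
  by apply: contraNneq vs => ->.
rewrite (expect_resample v); apply: eq_expect => w.
rewrite big_cons mulrA mulr_sumr mulr_suml.
by apply: eq_bigr => x _; rewrite upd_id hv ?mem_head// Fv ?mem_head//; ring.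
Qed.

End ProductLaw.

Lemma size_notin (V : finType) (s : seq V) : uniq s ->
  size [seq v <- enum V | v \notin s] = (#|V| - size s)%N.
Proof.
move=> us; rewrite -(cardC (mem s)) (card_uniqP us) addKn.
rewrite -(card_uniqP (filter_uniq _ (enum_uniq _))); apply: eq_card => v.
by rewrite mem_filter mem_enum andbT.
Qed.

(** * Exploration lists and components of the intersection graph *)

Section IntersectionGraph.
Variables (V T O : finType) (ob : T -> {set O}).
Implicit Types (w : {ffun V -> T}) (s : seq V) (A : {set O}).

Definition objects w s : {set O} := [set o | has (fun v => o \in ob (w v)) s].

Definition misses A (x : T) : bool := ob x :&: A == finset.set0.

(** The relation [adjacent] for abstract vertices and objects; with [ob := snd] the two are
    convertible. *)
Definition share w : rel V :=
  fun u v => (u != v) && (ob (w u) :&: ob (w v) != finset.set0).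

(* The head of the list is the vertex explored last. *)
Fixpoint chain w s : bool :=
  if s is v :: s' then
    ((s' == [::]) || ~~ misses (objects w s') (w v)) && chain w s'
  else true.

Definition closed_off w s : bool :=
  all (fun v => misses (objects w s) (w v)) [seq v <- enum V | v \notin s].

Lemma objects_cons w v s : objects w (v :: s) = ob (w v) :|: objects w s.
Proof. by apply/setP => o; rewrite !inE. Qed.

Lemma objects_nil w : objects w [::] = finset.set0.
Proof. by apply/setP => o; rewrite !inE. Qed.

Lemma objects_upd w v x s : v \notin s -> objects (upd w v x) s = objects w s.
Proof.
move=> vs; apply/setP => o; rewrite !inE; apply: eq_in_has => u us.
by rewrite upd_neq//; apply: contraNneq vs => <-.
Qed.

Lemma objects_sub w s s' : {subset s <= s'} -> objects w s \subset objects w s'.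
Proof.
move=> ss; apply/fintype.subsetP => o; rewrite !inE => /hasP[v vs vo].
by apply/hasP; exists v => //; apply: ss.
Qed.

Lemma chain_upd w v x s : v \notin s -> chain (upd w v x) s = chain w s.
Proof.
elim: s => //= u s IHs; rewrite inE negb_or => /andP[vu vs].
by rewrite objects_upd// IHs// upd_neq// eq_sym.
Qed.

Lemma missesP A x : reflect (forall o, o \in ob x -> o \notin A) (misses A x).
Proof.
apply: (iffP eqP) => [/setP h o ox|h].
  by have := h o; rewrite !inE ox /= => ->.
apply/setP => o; rewrite !inE; apply/negP => /andP[ox]; exact/negP/h.
Qed.

Lemma hit_objects w s v u :
  u \in s -> share w u v -> ~~ misses (objects w s) (w v).
Proof.
move=> us /andP[_ /set0Pn[x]]; rewrite inE => /andP[ou ov].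
apply/negP => /missesP/(_ _ ov); rewrite inE => /hasPn/(_ _ us).
by rewrite ou.
Qed.

Lemma share_sym w : symmetric (share w).
Proof. by move=> u v; rewrite /share eq_sym finset.setIC. Qed.

(** Grow the list from [x]. As long as it misses part of the component, a path from a listed vertex
    to a missing one has a first edge leaving the list, and the far end of this edge hits the
    objects found so far. *)
Lemma component_chain w x :
  exists s, [/\ uniq s, chain w s & s =i connect (share w) x].
Proof.
pose C := [set y | connect (share w) x y].
suff [s [us ws sC ss]] : exists s, [/\ uniq s, chain w s, {subset s <= C} & size s = #|C|].
  exists s; split => //; move=> y.
  have : s =i enum C.
    have sC' : {subset s <= enum C} by move=> z /sC; rewrite mem_enum.
    by have [|_ //] := uniq_min_size us sC'; rewrite -cardE ss.
  by move=> ->; rewrite mem_enum inE.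
have xC : x \in C by rewrite inE connect0.
have C0 : (0 < #|C|)%N by apply/card_gt0P; exists x.
suff H k : (0 < k <= #|C|)%N ->
    exists s, [/\ uniq s, chain w s, {subset s <= C} & size s = k].
  by apply: H; rewrite C0 leqnn.
elim: k => // -[|k] IHk /= kC.
  by exists [:: x]; split => // y; rewrite inE => /eqP ->.
have [s [us ws sC ss]] := IHk (ltnW kC).
have [y [ys yC]] : exists y, y \in s /\ y \in C.
  by case: s {us ws} sC ss => // y s sC _; exists y; rewrite mem_head sC ?mem_head.
have [z [zC zs]] : exists z, z \in C /\ z \notin s.
  apply: contrapT => h; move: kC; apply/negP; rewrite -leqNgt -ss -(card_uniqP us).
  apply/subset_leq_card/fintype.subsetP => z zC.
  by apply: contrapT => /negP zs; apply: h; exists z.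
have [u [v [us' vs uv]]] : exists u v, [/\ u \in s, v \notin s & share w u v].
  have : connect (share w) y z.
    move: yC zC; rewrite !inE => yC zC; apply: connect_trans zC.
    by rewrite (sym_connect_sym (@share_sym w)).
  case/connectP => p; elim: p y ys {yC} => [|y' p IHp] y ys /=.
    by move=> _ zy; rewrite zy ys in zs.
  move=> /andP[yy' y'p] zp; have [y's|y's] := boolP (y' \in s).
    exact: IHp y's y'p zp.
  by exists y, y'.
exists (v :: s); split => /=; rewrite ?vs ?us ?ws ?ss ?andbT//.
  by rewrite (hit_objects us')// orbT.
move=> a; rewrite inE => /orP[/eqP ->|/sC//].
have := sC _ us'; rewrite !inE => xu; apply: connect_trans xu (connect1 uv).
Qed.

(** Two unconnected vertices have disjoint components, the smaller of which has at most half of the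
    vertices. A component is closed off because a vertex sharing an object with it would belong to
    it. *)
Lemma disconnected_chain w :
  ~~ connected_graph (share w) ->
  exists s, [/\ uniq s, (0 < size s)%N, (size s <= #|V|./2)%N, chain w s & closed_off w s].
Proof.
rewrite negb_forall => /existsP[x]; rewrite negb_forall => /existsP[y xy].
have cs := sym_connect_sym (@share_sym w).
have comp z : exists s, [/\ uniq s, (0 < size s)%N, chain w s, closed_off w s
    & s =i connect (share w) z].
  have [s [us ws sC]] := component_chain w z; exists s; split => //.
    by rewrite lt0n size_eq0; apply/eqP => s0; have := sC z; rewrite s0 !inE connect0.
  apply/allP => v; rewrite mem_filter => /andP[vs _]; apply/missesP => o ov.
  rewrite inE; apply/hasPn => u us'; apply/negP => ou; move/negP: (vs); apply.
  have := us'; rewrite !sC !inE => zu; apply: connect_trans zu (connect1 _).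
  rewrite /share; apply/andP; split; last by apply/set0Pn; exists o; rewrite inE ou ov.
  by apply: contraNneq vs => <-.
have [s [us s0 ws cls sx]] := comp x; have [t [ut t0 wt clt ty]] := comp y.
have st : (size s + size t <= #|V|)%N.
  rewrite -size_cat -(@card_uniqP _ (s ++ t) _) ?max_card// cat_uniq us ut andbT /=.
  apply/hasPn => z; rewrite sx ty !inE => yz; apply: contra xy => xz.
  by rewrite (connect_trans xz)// cs.
have [h|h] := leqP (size s) (size t).
  by exists s; split => //; lia.
by exists t; split => //; lia.
Qed.

End IntersectionGraph.

(** * Binomial estimates *)

Section Binomials.

(** Factor by factor, [(P - u - j) * P <= (P - j) * (P - u)]. *)
Lemma ffact_mul_expn_le P u k :
  ((P - u) ^_ k * P ^ k <= P ^_ k * (P - u) ^ k)%N.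
Proof.
elim: k => [|k IHk]; first by rewrite !ffactn0 !expn0.
rewrite !ffactnSr !expnSr.
rewrite [X in (X <= _)%N]mulnACA [X in (_ <= X)%N]mulnACA leq_mul//; nia.
Qed.

(** Factor by factor, [(P - 2 * u - j) * (P - j) <= (P - u - j) ^ 2]. *)
Lemma ffact_double_le P u k :
  ((P - 2 * u) ^_ k * P ^_ k <= ((P - u) ^_ k) ^ 2)%N.
Proof.
elim: k => [|k IHk]; first by rewrite !ffactn0.
rewrite !ffactnSr expnMn mulnACA leq_mul//; nia.
Qed.

Lemma bin_mul_expn_le P u k : ('C(P - u, k) * P ^ k <= 'C(P, k) * (P - u) ^ k)%N.
Proof.
rewrite -(leq_pmul2r (fact_gt0 k)) mulnAC bin_ffact [X in (_ <= X)%N]mulnAC bin_ffact.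
exact: ffact_mul_expn_le.
Qed.

Lemma bin_double_le P u k : ('C(P - 2 * u, k) * 'C(P, k) <= 'C(P - u, k) ^ 2)%N.
Proof.
have k2 : (0 < k`! ^ 2)%N by rewrite expn_gt0 fact_gt0.
rewrite -(leq_pmul2r k2) -expnMn bin_ffact -mulnn mulnACA !bin_ffact.
exact: ffact_double_le.
Qed.

(** A union bound in counting form: a [k]-set meeting a fixed [u]-set contains one of its elements,
    and each element lies in a fraction [k / P] of all [k]-sets. Pascal's rule gives the induction
    on [u]. *)
Lemma bin_sub_ge P u k : (u <= P)%N -> (0 < k)%N ->
  (P * 'C(P, k) <= P * 'C(P - u, k) + u * k * 'C(P, k))%N.
Proof.
case: k => // k; move=> uP _.
rewrite -[X in (_ <= _ + X)%N]mulnA -mul_bin_diag mulnCA -mulnDr leq_mul2l; apply/orP; right.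
elim: u uP => [|u IHu] uP; first by rewrite subn0 mul0n addn0.
apply: leq_trans (IHu (ltnW uP)) _.
have -> : (P - u = (P - u.+1).+1)%N by lia.
rewrite binS mulSn addnA leq_add2r leq_add2l.
by apply: leq_bin2l; lia.
Qed.

End Binomials.

(** * Probability that a uniform set misses given objects *)

Section MissProbability.
Variable R : realType.

(** For [k, u <= P], the probability that a uniform [k]-subset of the pool misses a fixed
    [u]-subset. *)
Definition rho (P k u : nat) : R := 'C(P - u, k)%:R / 'C(P, k)%:R.

Lemma rho_ge0 P k u : 0 <= rho P k u.
Proof. by rewrite divr_ge0. Qed.

(** Drawing [k] objects without replacement stays inside a [t]-set with at most the probability of
    drawing with replacement. *)
Lemma bin_ratio_le_expn P k t : (0 < P)%N -> (k <= P)%N -> (t <= P)%N ->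
  'C(t, k)%:R / 'C(P, k)%:R <= (t%:R / P%:R) ^+ k :> R.
Proof.
move=> P0 kP tP; rewrite expr_div_n ler_pdivrMr ?ltr0n ?bin_gt0//.
rewrite mulrAC ler_pdivlMr ?exprn_gt0 ?ltr0n//.
rewrite -!natrX -!natrM ler_nat mulnC [X in (_ <= X)%N]mulnC.
by have := bin_mul_expn_le P (P - t) k; rewrite subKn// mulnC.
Qed.

Lemma rho_le1 P k u : (k <= P)%N -> rho P k u <= 1.
Proof.
by move=> kP; rewrite ler_pdivrMr ?ltr0n ?bin_gt0// mul1r ler_nat leq_bin2l ?leq_subr.
Qed.

Lemma rho_le_expR P k u : (0 < P)%N -> (k <= P)%N ->
  rho P k u <= expR (- (u%:R * k%:R / P%:R)).
Proof.
move=> P0 kP; apply: le_trans (bin_ratio_le_expn P0 kP (leq_subr _ _)) _.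
have -> : - (u%:R * k%:R / P%:R) = - (u%:R / P%:R) * k%:R :> R by ring.
rewrite expRM_natr lerXn2r ?nnegrE ?expR_ge0 ?divr_ge0//.
have P0' : 0 < P%:R :> R by rewrite ltr0n.
have [uP|Pu] := leqP u P.
  apply: le_trans (expR_ge1Dx _); rewrite natrB// mulrBl divff ?gt_eqF//.
by rewrite (_ : (P - u)%N = 0%N) ?mul0r ?expR_ge0//; lia.
Qed.

Lemma rho_ge P k u : (u <= P)%N -> (0 < k <= P)%N ->
  1 - u%:R * k%:R / P%:R <= rho P k u.
Proof.
move=> uP /andP[k0 kP]; have P0 : 0 < P%:R :> R by rewrite ltr0n; lia.
have := bin_sub_ge uP k0; rewrite -(ler_nat R) natrD !natrM => h.
rewrite ler_pdivlMr ?ltr0n ?bin_gt0// -(ler_pM2l P0) mulrA mulrBr mulr1.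
rewrite [P%:R * (_ / _)]mulrC divfK ?gt_eqF//; lra.
Qed.

(** Negative correlation: missing two disjoint [u]-sets is at most as likely as if the two events
    were independent. *)
Lemma rho_double P k u : (k <= P)%N -> rho P k (2 * u) <= rho P k u ^+ 2.
Proof.
move=> kP; have C0 : 0 < 'C(P, k)%:R :> R by rewrite ltr0n bin_gt0.
rewrite /rho expr_div_n ler_pdivlMr ?exprn_gt0// mulrAC expr2 mulrA mulfK ?gt_eqF//.
by rewrite -natrM -natrX ler_nat bin_double_le.
Qed.

Lemma rho_anti P k u v : (u <= v)%N -> rho P k v <= rho P k u.
Proof. by move=> uv; rewrite ler_wpM2r ?invr_ge0// ler_nat leq_bin2l// leq_sub2l. Qed.

(** The left side is one term in the expansion of [(1 + y) ^+ n], which is at most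
    [expR (n * y)]. *)
Lemma bin_mul_expr_le (n t : nat) (y : R) : 0 <= y ->
  'C(n, t)%:R * y ^+ t <= expR (n%:R * y).
Proof.
move=> y0; apply: (@le_trans _ _ ((1 + y) ^+ n)).
  rewrite exprDn; have [tn|nt] := leqP t n; last first.
    by rewrite bin_small// mul0r sumr_ge0// => i _; rewrite mulrn_wge0// mulr_ge0 ?exprn_ge0.
  rewrite (bigD1 (inord t))//= inordK// expr1n mul1r mulr_natl lerDl.
  by rewrite sumr_ge0// => i _; rewrite mulrn_wge0// mulr_ge0 ?exprn_ge0.
rewrite mulrC expRM_natr lerXn2r ?nnegrE ?addr_ge0 ?expR_ge0// expR_ge1Dx//.
Qed.

Lemma bin_le_expR (n t : nat) : (0 < n)%N ->
  'C(n, t)%:R * (t%:R / n%:R) ^+ t <= expR t%:R :> R.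
Proof.
move=> n0; have := @bin_mul_expr_le n t (t%:R / n%:R) ltac:(by rewrite divr_ge0).
by rewrite mulrC [n%:R * _]mulrC divfK// pnatr_eq0 -lt0n.
Qed.

End MissProbability.

(** * The law of the object sets *)

Section MixedLaw.
Variables (R : realType) (V : finType) (m P : nat).
Variables (al : V -> 'I_m -> R) (K : 'I_m -> nat).
Hypothesis al_ge0 : forall v i, 0 <= al v i.
Hypothesis al_sum1 : forall v, \sum_i al v i = 1.
Hypothesis K_le : forall i, (K i <= P)%N.

Local Notation T := ('I_m * {set 'I_P})%type.
Local Notation ob := (@snd 'I_m {set 'I_P}).
Local Notation nu := (fun v : V => @vertex_law R m P (al v) K).
Implicit Types (w : {ffun V -> T}) (s : seq V) (A : {set 'I_P}).

Lemma law_ge0 v (x : T) : 0 <= nu v x.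
Proof. by rewrite mulr_ge0//; case: ifP => // _; rewrite invr_ge0. Qed.

Lemma law_sum1 v : \sum_x nu v x = 1.
Proof. exact: vertex_law_sum1. Qed.

Lemma law_card v (x : T) : nu v x != 0 -> #|x.2| = K x.1 /\ al v x.1 != 0.
Proof.
rewrite /vertex_law mulf_eq0 negb_or => /andP[a0].
by case: ifP => [/eqP -> //|_]; rewrite eqxx.
Qed.

Lemma law_sum (v : V) (f : T -> R) :
  \sum_x nu v x * f x =
  \sum_i al v i * (\sum_(B : {set 'I_P} | #|B| == K i) 'C(P, K i)%:R^-1 * f (i, B)).
Proof.
rewrite (eq_bigr (fun p => nu v (p.1, p.2) * f (p.1, p.2))); last by case.
rewrite -(pair_big xpredT xpredT (fun i B => nu v (i, B) * f (i, B))) /=.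
apply: eq_bigr => i _; rewrite [in RHS]big_mkcond mulr_sumr; apply: eq_bigr => B _.
by rewrite /vertex_law /=; case: ifP => _; rewrite ?mulr0 ?mul0r// mulrA.
Qed.

Lemma law_subset v A :
  \sum_x nu v x * (ob x \subset A)%:R =
  \sum_i al v i * ('C(#|A|, K i)%:R / 'C(P, K i)%:R).
Proof.
rewrite law_sum; apply: eq_bigr => i _; congr (_ * _) => /=.
rewrite -mulr_sumr mulrC; congr (_ * _).
rewrite -natr_sum -cards_draws -sum1dep_card; congr (_%:R).
rewrite big_mkcond [in RHS]big_mkcond; apply: eq_bigr => B _ /=.
by rewrite andbC; case: (_ == _) => //=; case: (_ \subset _).
Qed.

Definition miss_prob v (u : nat) : R := \sum_i al v i * rho R P (K i) u.

Lemma law_misses v A :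
  \sum_x nu v x * (misses ob A x)%:R = miss_prob v #|A|.
Proof.
have cA : (P - #|A|)%N = #|~: A| by rewrite [RHS]cardsCs finset.setCK card_ord.
rewrite /miss_prob /rho cA -law_subset.
apply: eq_bigr => x _; congr (_ * _%:R).
by rewrite /misses setI_eq0 finset.disjoints_subset.
Qed.

Lemma miss_prob_ge0 v u : 0 <= miss_prob v u.
Proof. by apply: sumr_ge0 => i _; rewrite mulr_ge0// rho_ge0. Qed.

Lemma miss_prob_anti v u u' : (u <= u')%N -> miss_prob v u' <= miss_prob v u.
Proof. by move=> uu; apply: ler_sum => i _; rewrite ler_wpM2l// rho_anti. Qed.

(** A union with at most [t] elements can be padded with further objects to a set of size exactly
    [t], whose term in the sum is 1. *)
Lemma card_objects_le w s t : (t <= P)%N ->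
  ((#|objects ob w s| <= t)%N)%:R <=
  \sum_(A : {set 'I_P} | #|A| == t) \prod_(v <- s) (ob (w v) \subset A)%:R :> R.
Proof.
move=> tP; set U := objects _ _ _.
have S0 (A : {set 'I_P}) : 0 <= \prod_(v <- s) (ob (w v) \subset A)%:R :> R.
  by rewrite big_seq prodr_ge0.
case: leqP => [Ut|_] /=; last by rewrite sumr_ge0.
have : (0 < #|[set B : {set 'I_P} | B \subset ~: U & #|B| == (t - #|U|)%N]|)%N.
  by rewrite cards_draws bin_gt0 [X in (_ <= X)%N]cardsCs finset.setCK card_ord leq_sub2r.
case/card_gt0P => B; rewrite inE => /andP[BU /eqP cB].
have cUB : #|U :|: B| == t.
  rewrite cardsU (_ : U :&: B = finset.set0) ?cards0; first by rewrite cB; lia.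
  by apply/eqP; rewrite finset.setIC setI_eq0 finset.disjoints_subset.
rewrite (bigD1 (U :|: B))//= big1_seq ?lerDl ?sumr_ge0// => v /= vs.
rewrite (_ : _ \subset _)//; apply/fintype.subsetP => x xv.
by rewrite !inE; apply/orP; left; apply/hasP; exists v.
Qed.

(* Union bound over the [t]-element sets [A] that contain all objects of [s],
   with ['C(P, t) * (t / P) ^ t <= exp t]. *)
Lemma union_small s t k : (0 < P)%N -> (t <= P)%N -> uniq s ->
  (forall v i, v \in s -> al v i != 0 -> (k <= K i)%N) -> (t <= size s * k)%N ->
  expect nu (fun w => (#|objects ob w s| <= t)%N%:R) <=
  expR t%:R * (t%:R / P%:R) ^+ (size s * k - t).
Proof.
move=> P0 tP us kK tk; set y : R := t%:R / P%:R.
have y0 : 0 <= y by rewrite divr_ge0.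
have y1 : y <= 1 by rewrite ler_pdivrMr ?ltr0n// mul1r ler_nat.
apply: (@le_trans _ _ (\sum_(A : {set 'I_P} | #|A| == t) y ^+ (size s * k))).
  apply: le_trans (le_expect law_ge0 (fun w _ => card_objects_le w s tP)) _.
  rewrite expect_sum; apply: ler_sum => A /eqP cA.
  have -> : expect nu (fun w => \prod_(v <- s) (ob (w v) \subset A)%:R) =
     expect nu (fun w => 1 * \prod_(v <- s) (ob (w v) \subset A)%:R).
    by apply: eq_expect => w; rewrite mul1r.
  rewrite (expect_fresh law_sum1 (F := fun=> 1) (h := fun _ x => (ob x \subset A)%:R))//.
  rewrite expectZ mul1r -[X in _ <= X](expect_cst law_sum1) mulnC exprM.
  apply: le_expect => [|w _]; first exact: law_ge0.
  have -> : (y ^+ k) ^+ size s = \prod_(v <- s) y ^+ k.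
    by rewrite big_const_seq count_predT iter_mulr_1.
  rewrite big_seq [X in _ <= X]big_seq.
  apply: ler_prod => v vs; rewrite sumr_ge0 /=; last by move=> x _; rewrite mulr_ge0 ?law_ge0.
  rewrite law_subset cA -[X in _ <= X]mul1r -[X in _ <= X * _](al_sum1 v) mulr_suml.
  apply: ler_sum => i _; have [->|a0] := eqVneq (al v i) 0; first by rewrite !mul0r.
  rewrite ler_wpM2l//. apply: le_trans (bin_ratio_le_expn R P0 (K_le i) tP) _.
  by rewrite ler_wiXn2l// (kK v).
rewrite sumr_const -cardsE card_draws card_ord -[X in X <= _]mulr_natl.
have -> : y ^+ (size s * k) = y ^+ t * y ^+ (size s * k - t) by rewrite -exprD subnKC.
rewrite mulrA ler_wpM2r ?exprn_ge0//.
exact: bin_le_expR.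
Qed.

Lemma closed_off_prod w s :
  (closed_off ob w s)%:R =
  \prod_(v <- [seq v <- enum V | v \notin s]) (misses ob (objects ob w s) (w v))%:R :> R.
Proof.
rewrite /closed_off; elim: [seq _ <- _ | _] => [|v l IHl]; first by rewrite big_nil.
by rewrite big_cons /= -IHl; case: misses; rewrite ?mul1r ?mul0r.
Qed.

(** Once the vertices of [s] are fixed, the outside vertices are independent, and each misses the
    objects of [s] with a probability depending only on their number. *)
Lemma expect_closed_off s (F : {ffun V -> T} -> R) :
  (forall w v x, v \notin s -> F (upd w v x) = F w) ->
  expect nu (fun w => F w * (closed_off ob w s)%:R) =
  expect nu (fun w => F w *
    \prod_(v <- [seq v <- enum V | v \notin s]) miss_prob v #|objects ob w s|).
Proof.
move=> Fs; pose h w (x : T) : R := (misses ob (objects ob w s) x)%:R.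
transitivity (expect nu (fun w => F w * \prod_(v <- [seq v <- enum V | v \notin s]) h w (w v))).
  by apply: eq_expect => w; rewrite closed_off_prod.
rewrite (expect_fresh law_sum1).
- by apply: eq_expect => w; congr (_ * _); apply: eq_bigr => v _; exact: law_misses.
- by rewrite filter_uniq// enum_uniq.
- by move=> w v x; rewrite mem_filter => /andP[vs _]; exact: Fs.
- move=> w v x; rewrite mem_filter => /andP[vs _]; apply/funext => z.
  by rewrite /h objects_upd.
Qed.

End MixedLaw.

(** * Exploring a component *)

(** The function [z ^+ k * expR (- (N * z))] decreases beyond [k / N]. Instead of a derivative, the
    proof uses [y <= x * expR ((y - x) / x)]. *)
Lemma powexp_anti (R : realType) (k : nat) (N x y : R) :
  0 <= N -> 0 <= x -> x <= y -> k%:R <= N * x ->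
  y ^+ k * expR (- (N * y)) <= x ^+ k * expR (- (N * x)).
Proof.
move=> N0 x0 xy kN; rewrite expRN ler_pdivrMr ?expR_gt0// -mulrA -expRD.
have -> : - (N * x) + N * y = N * (y - x) by ring.
case: k kN => [|k] kN.
  by rewrite !expr0 mul1r -expR0 ler_expR mulr_ge0// subr_ge0.
have {}x0 : 0 < x.
  by rewrite lt_neqAle x0 andbT; apply: contraTneq kN => <-; rewrite mulr0 -ltNge.
apply: (@le_trans _ _ ((x * expR ((y - x) / x)) ^+ k.+1)).
  rewrite lerXn2r ?nnegrE ?mulr_ge0 ?expR_ge0 ?(ltW x0) ?(le_trans (ltW x0))//.
  apply: (@le_trans _ _ (x * (1 + (y - x) / x))).
    by rewrite mulrDr mulr1 mulrC divfK ?gt_eqF//; lra.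
  by rewrite ler_pM2l// expR_ge1Dx.
rewrite exprMn ler_pM2l ?exprn_gt0// -expRM_natr ler_expR.
rewrite (_ : _ / x * _ = k.+1%:R / x * (y - x)); last by ring.
by rewrite ler_wpM2r ?subr_ge0// ler_pdivrMr.
Qed.

(** * Absence of edges between two vertex lists *)

Section NoEdges.
Variables (R : realType) (V : finType) (m P : nat).
Variables (al : V -> 'I_m -> R) (K : 'I_m -> nat).
Hypothesis al_ge0 : forall v i, 0 <= al v i.
Hypothesis al_sum1 : forall v, \sum_i al v i = 1.
Hypothesis K_le : forall i, (K i <= P)%N.
Hypothesis P_gt0 : (0 < P)%N.

Local Notation T := ('I_m * {set 'I_P})%type.
Local Notation ob := (@snd 'I_m {set 'I_P}).
Local Notation nu := (fun v : V => @vertex_law R m P (al v) K).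

Lemma miss_prob_le_expR v u k :
  (forall i, al v i != 0 -> (k <= K i)%N) ->
  miss_prob P al K v u <= expR (- (u%:R * k%:R / P%:R)).
Proof.
move=> kK; rewrite -[X in _ <= X]mul1r -[X in _ <= X * _](al_sum1 v) mulr_suml.
apply: ler_sum => i _; have [->|a0] := eqVneq (al v i) 0; first by rewrite !mul0r.
rewrite ler_wpM2l//; apply: le_trans (rho_le_expR R u P_gt0 (K_le i)) _.
by rewrite ler_expR lerN2 ler_wpM2r ?invr_ge0// ler_wpM2l// ler_nat kK.
Qed.

(** Either the objects of [s] number at most [t], or each vertex of [B] independently has to miss at
    least [t.+1] objects. *)
Lemma no_edge_prob (s B : seq V) (t lam : nat) :
  uniq B -> {in B, forall v, v \notin s} ->
  (forall v i, v \in B -> al v i != 0 -> (lam <= K i)%N) ->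
  expect nu (fun w => (all (fun v => misses ob (objects ob w s) (w v)) B)%:R) <=
  expect nu (fun w => (#|objects ob w s| <= t)%N%:R) +
  expR (- ((size B)%:R * lam%:R * t.+1%:R / P%:R)).
Proof.
move=> uB Bs lamK; set U := fun w => objects ob w s.
pose h w (x : T) : R := (misses ob (U w) x)%:R.
pose F w : R := (t < #|U w|)%N%:R.
have law0 := @law_ge0 R V m P al K al_ge0.
have law1 := @law_sum1 R V m P al K al_sum1 K_le.
apply: (@le_trans _ _ (expect nu (fun w => (#|U w| <= t)%N%:R + F w * \prod_(v <- B) h w (w v)))).
  apply: le_expect => // w _; have -> : \prod_(v <- B) h w (w v) =
      (all (fun v => misses ob (U w) (w v)) B)%:R.
    elim: (B) => [|v l IHl]; first by rewrite big_nil.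
    by rewrite big_cons /= IHl /h; case: misses; rewrite ?mul1r ?mul0r.
  by rewrite /F ltnNge; case: leqP; case: all => /=; rewrite ?mulr1 ?mul0r ?mulr0 ?addr0 ?add0r.
rewrite expectD lerD2l (expect_fresh law1)//; first last.
- by move=> w v x /Bs vs; apply/funext => z; rewrite /h /U objects_upd.
- by move=> w v x /Bs vs; rewrite /F /U objects_upd.
rewrite -[X in _ <= X](expect_cst law1); apply: le_expect => // w _.
rewrite /F; case: ltnP => [tU|_] /=; last by rewrite mul0r expR_ge0.
rewrite mul1r.
have -> : expR (- ((size B)%:R * lam%:R * t.+1%:R / P%:R)) =
    \prod_(v <- B) expR (- (t.+1%:R * lam%:R / P%:R)) :> R.
  rewrite big_const_seq count_predT iter_mulr_1 -expRM_natr; congr expR; ring.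
rewrite big_seq [X in _ <= X]big_seq; apply: ler_prod => v vB.
rewrite law_misses//= miss_prob_ge0//=.
apply: le_trans (miss_prob_le_expR _ (fun i => lamK v i vB)) _.
by rewrite ler_expR lerN2 !ler_wpM2r ?invr_ge0// ler_nat.
Qed.

End NoEdges.

(** * Weights of exploration chains *)

Section Chains.
Variables (R : realType) (V : finType) (m P : nat).
Variables (a : 'I_m -> R) (K : 'I_m -> nat).
Hypothesis a_ge0 : forall i, 0 <= a i.
Hypothesis a_sum1 : \sum_i a i = 1.
Hypothesis K_le : forall i, (K i <= P)%N.

Local Notation T := ('I_m * {set 'I_P})%type.
Local Notation ob := (@snd 'I_m {set 'I_P}).
Local Notation nu := (fun v : V => @vertex_law R m P a K).
Implicit Types (w : {ffun V -> T}) (s : seq V).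

(** At [u = K i] this is [edge_prob] for group [i], by conversion. *)
Definition hit_prob (u : nat) : R := \sum_i a i * (1 - rho R P (K i) u).

Lemma miss_probE (v : V) u : miss_prob P (fun=> a) K v u = 1 - hit_prob u.
Proof.
rewrite /hit_prob (eq_bigr (fun i => a i - a i * rho R P (K i) u)); last by move=> i _; ring.
by rewrite big_split/= a_sum1 sumrN opprD opprK addrA subrr add0r.
Qed.

Lemma hit_prob_ge0 u : 0 <= hit_prob u.
Proof. by apply: sumr_ge0 => i _; rewrite mulr_ge0// subr_ge0 rho_le1. Qed.

Lemma hit_prob_mono u u' : (u <= u')%N -> hit_prob u <= hit_prob u'.
Proof. by move=> uu; apply: ler_sum => i _; rewrite ler_wpM2l// lerB// rho_anti. Qed.

Let law0 := @law_ge0 R V m P (fun=> a) K (fun=> a_ge0).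
Let law1 := @law_sum1 R V m P (fun=> a) K (fun=> a_sum1) K_le.

Lemma expect_hit s v (F : {ffun V -> T} -> R) :
  v \notin s -> (forall w x, F (upd w v x) = F w) ->
  expect nu (fun w => F w * (~~ misses ob (objects ob w s) (w v))%:R) =
  expect nu (fun w => F w * hit_prob #|objects ob w s|).
Proof.
move=> vs Fv; pose h w (x : T) : R := (~~ misses ob (objects ob w s) x)%:R.
transitivity (expect nu (fun w => F w * \prod_(v <- [:: v]) h w (w v))).
  by apply: eq_expect => w; rewrite big_seq1.
rewrite (expect_fresh law1)//.
- apply: eq_expect => w; congr (_ * _); rewrite big_seq1.
  transitivity (\sum_x (nu v x - nu v x * (misses ob (objects ob w s) x)%:R)).
    by apply: eq_bigr => x _; rewrite /h; case: misses => /=; ring.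
  rewrite sumrB (law1 v) (@law_misses R V m P (fun=> a) K v) miss_probE; ring.
- by move=> w u x; rewrite inE => /eqP ->; exact: Fv.
- by move=> w u x; rewrite inE => /eqP ->; apply/funext => z; rewrite /h objects_upd.
Qed.

Section Weight.
Variables (N q0 : R).
Hypotheses (N_ge0 : 0 <= N) (q0_ge0 : 0 <= q0).

(* [phi k] is antitone once [k <= N * q0], so enlarging the set of objects can
   be neglected at each exploration step, which gains one factor [hit_prob]. *)
Let phi k (x : R) := Num.max x q0 ^+ k * expR (- (N * Num.max x q0)).

(** Induction that removes the vertex explored last; [k] counts the hit factors already
    collected. *)
Lemma chain_weight s k : s != [::] -> uniq s -> (k + (size s).-1)%:R <= N * q0 ->
  expect nu (fun w => (chain ob w s)%:R * phi k (hit_prob #|objects ob w s|)) <=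
  q0 ^+ (k + (size s).-1) * expR (- (N * q0)).
Proof.
have phi_anti j x y : j%:R <= N * q0 -> x <= y -> phi j y <= phi j x.
  move=> jN xy; apply: powexp_anti => //.
  - by rewrite le_max q0_ge0 orbT.
  - by rewrite ge_max !le_max xy lexx orbT.
  - by apply: le_trans jN _; rewrite ler_wpM2l// le_max lexx orbT.
have phi0 j x : 0 <= phi j x.
  by rewrite mulr_ge0 ?expR_ge0// exprn_ge0// le_max q0_ge0 orbT.
elim: s k => // v s IHs k _ /= /andP[vs us].
(* The vertex explored first has nothing to hit and contributes no factor, hence the exponent
   [(size s).-1]. *)
have [s0|s0] := eqVneq s [::] => /= kN.
  rewrite s0 addn0; rewrite s0 addn0 in kN.
  rewrite -[X in _ <= X](expect_cst law1); apply: le_expect => // w _.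
  rewrite mul1r; have -> : q0 ^+ k * expR (- (N * q0)) = phi k q0 by rewrite /phi maxxx.
  rewrite /phi maxxx; apply: powexp_anti => //; by rewrite le_max lexx orbT.
have ks : (k + size s = k.+1 + (size s).-1)%N.
  by case: (s) s0 => //= *; rewrite addnS.
have kN' : k%:R <= N * q0 by apply: le_trans kN; rewrite ler_nat leq_addr.
apply: (@le_trans _ _ (expect nu (fun w =>
   (chain ob w s)%:R * phi k (hit_prob #|objects ob w s|) *
   (~~ misses ob (objects ob w s) (w v))%:R))).
  apply: le_expect => // w _; case: misses; case: chain => /=; rewrite ?mul0r ?mulr0 ?mulr1 ?mul1r//.
  by apply: phi_anti => //; apply: hit_prob_mono; rewrite subset_leq_card// objects_cons finset.subsetUr.
rewrite expect_hit//; last by move=> w x; rewrite chain_upd// objects_upd.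
rewrite ks; rewrite ks in kN; apply: le_trans (IHs _ s0 us kN).
apply: le_expect => // w _; rewrite -mulrA ler_wpM2l// /phi exprSr mulrAC.
by rewrite ler_wpM2r ?expR_ge0// ler_wpM2l ?le_max ?lexx// exprn_ge0// le_max q0_ge0 orbT.
Qed.

End Weight.

(** If [x] is the hit probability of the objects of [s], the outside vertices all miss them with
    probability [(1 - x) ^+ (#|V| - size s)], at most the exponential weight with which
    [chain_weight] starts at [k = 0]. *)
Lemma component_prob s (u : nat) (q0 : R) :
  uniq s -> (0 < size s)%N -> 0 <= q0 <= hit_prob u ->
  (size s).-1%:R <= (#|V| - size s)%:R * q0 ->
  expect nu (fun w => [&& (u <= #|objects ob w s|)%N, chain ob w s & closed_off ob w s]%:R) <=
  q0 ^+ (size s).-1 * expR (- ((#|V| - size s)%:R * q0)).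
Proof.
move=> us s0 /andP[q00 q0u] sN.
pose F w : R := ((u <= #|objects ob w s|)%N && chain ob w s)%:R.
have -> : expect nu (fun w => [&& (u <= #|objects ob w s|)%N, chain ob w s & closed_off ob w s]%:R) =
    expect nu (fun w => F w * (closed_off ob w s)%:R).
  apply: eq_expect => w; rewrite /F.
  by case: (u <= _)%N; case: chain; case: closed_off; rewrite /= ?mul1r ?mul0r.
rewrite (expect_closed_off (fun=> a_sum1) K_le); last first.
  by move=> w v x vs; rewrite /F objects_upd// chain_upd.
apply: le_trans (chain_weight (s := s) (k := 0) (N := (#|V| - size s)%:R) _ q00 _ us _) => //; last first.
  by rewrite -size_eq0 -lt0n.
apply: le_expect => // w _; rewrite expr0 mul1r /F.
case: leqP => [uU|_] /=; last by rewrite mul0r mulr_ge0 ?expR_ge0.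
rewrite ler_wpM2l//.
set x := hit_prob _; have q0x : q0 <= x by apply: le_trans q0u (hit_prob_mono _).
rewrite (eq_bigr (fun=> 1 - x)); last by move=> v _; rewrite miss_probE.
rewrite big_const_seq count_predT iter_mulr_1 (max_l q0x).
rewrite size_notin//.
rewrite mulrC -mulNr expRM_natr lerXn2r ?nnegrE ?expR_ge0//.
  by case: (s) s0 => // v _ _; rewrite -(miss_probE v) miss_prob_ge0.
exact: expR_ge1Dx.
Qed.

End Chains.

(** * Conditioning on the group assignment *)

Section Conditioning.
Variables (R : realType) (m n P : nat) (a : 'I_m -> R) (K : 'I_m -> nat).

(** Conditioning changes the group laws and keeps the sample space, so every result on
    vertex-dependent group laws applies given [tau]. *)
Definition point_mass (tau : {ffun 'I_n -> 'I_m}) (v : 'I_n) (i : 'I_m) : R := (i == tau v)%:R.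

Lemma point_mass_ge0 tau v i : 0 <= point_mass tau v i.
Proof. by []. Qed.

Lemma point_mass_sum1 tau v : \sum_i point_mass tau v i = 1.
Proof. by rewrite (bigD1 (tau v))//= /point_mass eqxx big1 ?addr0// => i /negPf ->. Qed.

Lemma Prob_expect (E : pred (outcome m n P)) :
  Prob a K E = expect (fun=> vertex_law a K) (fun w => (E w)%:R).
Proof.
rewrite /Prob big_mkcond; apply: eq_bigr => w _.
by case: (E w); rewrite ?mulr1 ?mulr0.
Qed.

(** Each vertex law is the [a]-mixture of the laws with a known group; the product over the vertices
    distributes over these sums. *)
Lemma Prob_condition (E : pred (outcome m n P)) :
  Prob a K E =
  \sum_(tau : {ffun 'I_n -> 'I_m}) (\prod_v a (tau v)) *
    expect (fun v => vertex_law (point_mass tau v) K) (fun w => (E w)%:R).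
Proof.
rewrite Prob_expect /expect.
transitivity (\sum_(w : outcome m n P) \sum_(tau : {ffun 'I_n -> 'I_m})
   \prod_v (a (tau v) * vertex_law (point_mass tau v) K (w v)) * (E w)%:R).
  apply: eq_bigr => w _; rewrite -mulr_suml; congr (_ * _).
  pose h v i : R := a i * (((w v).1 == i)%:R * vertex_law (fun=> 1) K (w v)).
  transitivity (\sum_(tau : {ffun 'I_n -> 'I_m}) \prod_v h v (tau v)); last first.
    apply: eq_bigr => tau _; apply: eq_bigr => v _.
    by rewrite /h /vertex_law mul1r.
  rewrite -(bigA_distr_bigA h) /h /=.
  apply: eq_bigr => v _; rewrite (bigD1 (w v).1)//= eqxx big1 ?addr0; last first.
    by move=> i /negPf; rewrite eq_sym => ->; rewrite mul0r mulr0.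
  by rewrite /vertex_law !mul1r.
rewrite exchange_big; apply: eq_bigr => tau _; rewrite mulr_sumr.
by apply: eq_bigr => w _; rewrite big_split/= mulrA.
Qed.

End Conditioning.

(** * Second moment of the isolated vertices *)

Section SecondMoment.
Variables (R : realType) (m n P : nat).
Variables (a : 'I_m -> R) (K : 'I_m -> nat) (i0 : 'I_m).
Hypothesis a_ge0 : forall i, 0 <= a i.
Hypothesis a_sum1 : \sum_i a i = 1.
Hypothesis K_le : forall i, (K i <= P)%N.

Local Notation T := ('I_m * {set 'I_P})%type.
Local Notation ob := (@snd 'I_m {set 'I_P}).
Local Notation nu := (fun v : 'I_n => @vertex_law R m P a K).
Implicit Types (w : {ffun 'I_n -> T}).

Let law0 := @law_ge0 R _ m P (fun _ : 'I_n => a) K (fun=> a_ge0).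
Let law1 := @law_sum1 R _ m P (fun _ : 'I_n => a) K (fun=> a_sum1) K_le.
Let b : R := hit_prob P a K (K i0).

Let I w (v : 'I_n) : bool := ((w v).1 == i0) && closed_off ob w [:: v].

Lemma expect_group v : expect nu (fun w => ((w v).1 == i0)%:R) = a i0.
Proof.
rewrite (expect_coord law1 v (fun x => (x.1 == i0)%:R)) (law_sum (fun=> a) K v) (bigD1 i0)//=.
rewrite [X in _ + X]big1 => [|i /negPf ii0]; last first.
  by rewrite big1 ?mulr0// => B _; rewrite ii0 mulr0.
rewrite addr0 (eq_bigr (fun=> 'C(P, K i0)%:R^-1)); last by move=> B _; rewrite eqxx mulr1.
rewrite sumr_const -cardsE card_draws card_ord -[X in _ * X]mulr_natr mulVf ?mulr1//.
by rewrite pnatr_eq0 -lt0n bin_gt0.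
Qed.

(** On the support a vertex of group [i0] holds exactly [K i0] objects, which each of the [n.-1]
    others misses with probability [1 - b]. *)
Lemma expect_isolated v :
  expect nu (fun w => (I w v)%:R) = a i0 * (1 - b) ^+ n.-1.
Proof.
pose F w : R := ((w v).1 == i0)%:R.
transitivity (expect nu (fun w => F w * (closed_off ob w [:: v])%:R)).
  by apply: eq_expect => w; rewrite /I /F; case: eqP; rewrite /= ?mul1r ?mul0r.
rewrite (@expect_closed_off R _ m P (fun=> a) K (fun=> a_sum1) K_le); last first.
  by move=> w u x; rewrite inE => uv; rewrite /F upd_neq// eq_sym.
transitivity (expect nu (fun w => (1 - b) ^+ n.-1 * F w)); last first.
  by rewrite expectZ expect_group mulrC.
apply: eq_bigr => w _; have [w0|w0] := eqVneq (\prod_v nu v (w v)) 0.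
  by rewrite w0 !mul0r.
congr (_ * _); rewrite mulrC /F; case: eqP => [wv|]; last by rewrite !mulr0.
rewrite !mulr1 (eq_bigr (fun=> 1 - b)); last first.
  move=> u _; rewrite miss_probE// objects_cons objects_nil finset.setU0.
  have : nu v (w v) != 0 by apply: contraNneq w0 => h; rewrite (bigD1 v)//= h mul0r.
  by move=> /(@law_card R _ m P (fun _ : 'I_n => a) K v) [-> _]; rewrite wv.
by rewrite big_const_seq count_predT iter_mulr_1 size_notin// card_ord subn1.
Qed.

(** Two isolated vertices have disjoint object sets. Together they hold [2 * K i0] objects, all of
    which the other [n - 2] vertices have to miss. *)
Lemma expect_isolated2 u v : u != v ->
  expect nu (fun w => (I w u && I w v)%:R) <=
  a i0 ^+ 2 * miss_prob P (fun=> a) K u (2 * K i0) ^+ (n - 2).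
Proof.
move=> uv; set M := miss_prob _ _ _ _ _.
pose G w : R := \prod_(z <- [:: u; v]) ((w z).1 == i0)%:R.
pose F w : R := G w * ((2 * K i0) <= #|objects ob w [:: u; v]|)%N%:R.
have uuv : uniq [:: u; v] by rewrite /= inE uv.
have M0 : 0 <= M by apply: miss_prob_ge0.
have G0 w : 0 <= G w by rewrite prodr_ge0.
have EG : expect nu G = a i0 ^+ 2.
  transitivity (expect nu (fun w => 1 * G w)); first by apply: eq_expect => w; rewrite mul1r.
  rewrite (expect_fresh law1 (F := fun=> 1) (h := fun _ x => (x.1 == i0)%:R))//.
  rewrite -[RHS](expect_cst law1); apply: eq_expect => w.
  rewrite mul1r !big_cons big_nil mulr1 expr2.
  have Eg z : \sum_x nu z x * (x.1 == i0)%:R = a i0.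
    by rewrite -(expect_group z) (expect_coord law1 z (fun x => (x.1 == i0)%:R)).
  by congr (_ * _); exact: Eg.
apply: (@le_trans _ _ (expect nu (fun w => F w * (closed_off ob w [:: u; v])%:R))).
  apply: le_expect => // w wsup; case: (boolP (_ && _)) => /=; last first.
    by rewrite mulr_ge0// mulr_ge0.
  move=> /andP[/andP[wu /allP cu] /andP[wv /allP cv]].
  have muv : misses ob (objects ob w [:: u]) (w v).
    by apply: cu; rewrite mem_filter inE eq_sym uv mem_enum.
  have cuv : closed_off ob w [:: u; v].
    apply/allP => z; rewrite mem_filter !inE negb_or => /andP[/andP[zu zv] ze].
    apply/missesP => x xz; rewrite !inE /= orbF negb_or.
    have /missesP/(_ _ xz) : misses ob (objects ob w [:: u]) (w z).
      by apply: cu; rewrite mem_filter inE zu.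
    have /missesP/(_ _ xz) : misses ob (objects ob w [:: v]) (w z).
      by apply: cv; rewrite mem_filter inE zv.
    by rewrite !inE /= !orbF => -> ->.
  rewrite cuv mulr1 /F /G !big_cons big_nil wu wv !mul1r.
  rewrite (_ : (_ <= _)%N = true)// !objects_cons objects_nil finset.setU0 cardsU.
  have := @law_card R _ m P (fun _ : 'I_n => a) K u _ (wsup u) => -[-> _].
  have := @law_card R _ m P (fun _ : 'I_n => a) K v _ (wsup v) => -[-> _].
  rewrite (eqP wu) (eqP wv) (_ : _ :&: _ = finset.set0) ?cards0; first by lia.
  by move: muv => /eqP; rewrite objects_cons objects_nil finset.setU0 finset.setIC.
rewrite (@expect_closed_off R _ m P (fun=> a) K (fun=> a_sum1) K_le); last first.
  move=> w z x zs; rewrite /F /G objects_upd//.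
  move: zs; rewrite !inE negb_or => /andP[zu zv].
  by rewrite !big_cons !big_nil !upd_neq 1?eq_sym.
rewrite -EG mulrC -expectZ; apply: le_expect => // w _.
rewrite /F; case: leqP => [UK|_]; last by rewrite mulr0 mul0r mulr_ge0// exprn_ge0.
rewrite mulr1 mulrC ler_wpM2r//.
have -> : M ^+ (n - 2) = \prod_(z <- [seq z <- enum 'I_n | z \notin [:: u; v]]) M.
  by rewrite big_const_seq count_predT iter_mulr_1 size_notin// card_ord.
rewrite big_seq [X in _ <= X]big_seq; apply: ler_prod => z _.
by rewrite miss_prob_ge0//=; exact: (@miss_prob_anti R _ m P (fun=> a) K (fun=> a_ge0) u _ _ UK).
Qed.

(** Chebyshev's inequality: a connected graph on more than one vertex has [X = 0], so there
    [(X - mu) ^+ 2] equals [mu ^+ 2]. In the second moment the diagonal pairs contribute [mu]. *)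
Lemma connected_second_moment (mu := n%:R * (a i0 * (1 - b) ^+ n.-1)) :
  (1 < n)%N -> 0 < mu ->
  forall v : 'I_n,
  prob_connected n P a K <=
  (mu + n%:R ^+ 2 * (a i0 ^+ 2 * miss_prob P (fun=> a) K v (2 * K i0) ^+ (n - 2)) - mu ^+ 2)
   / mu ^+ 2.
Proof.
move=> n1 mu0 v0; set M2 := _ ^+ 2 * _ ^+ (n - 2).
have M20 : 0 <= M2 by rewrite mulr_ge0 ?exprn_ge0// miss_prob_ge0.
pose X w : R := \sum_v (I w v)%:R.
have mu2 : 0 < mu ^+ 2 by rewrite exprn_gt0.
have EX : expect nu X = mu.
  by rewrite expect_sum (eq_bigr _ (fun v _ => expect_isolated v)) sumr_const card_ord -mulr_natl.
have EX2 : expect nu (fun w => X w ^+ 2) <= mu + n%:R ^+ 2 * M2.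
  have -> : expect nu (fun w => X w ^+ 2) =
      \sum_u \sum_v expect nu (fun w => (I w u && I w v)%:R).
    transitivity (expect nu (fun w => \sum_u \sum_v (I w u && I w v)%:R)).
      apply: eq_expect => w; rewrite expr2 mulr_suml; apply: eq_bigr => u _.
      by rewrite mulr_sumr; apply: eq_bigr => v _; case: (I w u); rewrite ?mul1r ?mul0r.
    by rewrite expect_sum; apply: eq_bigr => u _; rewrite expect_sum.
  have -> : mu + n%:R ^+ 2 * M2 = \sum_(u < n) (a i0 * (1 - b) ^+ n.-1 + n%:R * M2).
    by rewrite sumr_const card_ord -[RHS]mulr_natl /mu; ring.
  apply: ler_sum => u _; rewrite (bigD1 u)//= lerD//.
    by rewrite -(expect_isolated u); apply: le_expect => // w _; rewrite andbb.
  apply: (@le_trans _ _ (\sum_(v < n) M2)); last by rewrite sumr_const card_ord mulr_natl.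
  rewrite [X in _ <= X](bigD1 u)//= ler_wpDl//; apply: ler_sum => v vu.
  by rewrite expect_isolated2// eq_sym.
rewrite /prob_connected Prob_expect ler_pdivlMr//.
apply: (@le_trans _ _ (expect nu (fun w => (X w - mu) ^+ 2))); last first.
  have -> : expect nu (fun w => (X w - mu) ^+ 2) =
     expect nu (fun w => X w ^+ 2) + ((- 2 * mu) * expect nu X + mu ^+ 2).
    rewrite -(expect_cst law1 (mu ^+ 2)) -expectZ -!expectD.
    by apply: eq_expect => w; ring.
  by rewrite EX; lra.
rewrite mulrC -expectZ; apply: le_expect => // w _.
case: (boolP (connected_graph _)) => cg; last by rewrite mulr0 sqr_ge0.
rewrite (_ : X w = 0) ?sub0r ?sqrrN ?mulr1// /X big1// => v _.
rewrite (_ : I w v = false)//; apply/negP => /andP[_ /allP cv].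
have [u uv] : exists u : 'I_n, u != v.
  have [->|vn] := eqVneq v (Ordinal n1); first by exists (Ordinal (ltnW n1)).
  by exists (Ordinal n1); rewrite eq_sym.
move: cg => /forallP/(_ v)/forallP/(_ u)/connectP[[|z p] /=].
  by move=> _ zv; rewrite zv eqxx in uv.
move=> /andP[/andP[vz /set0Pn[x xvz]] _] _; move: xvz; rewrite inE => /andP[xv xz].
have : misses ob (objects ob w [:: v]) (w z) by apply: cv; rewrite mem_filter inE eq_sym vz mem_enum.
by move=> /missesP/(_ _ xz); rewrite !inE /= xv.
Qed.

End SecondMoment.

(** * Union bound over components *)

Section UnionBound.
Variables (R : realType) (m n P : nat).
Variables (a : 'I_m -> R) (K : 'I_m -> nat) (i0 im : 'I_m).
Hypothesis a_ge0 : forall i, 0 <= a i.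
Hypothesis a_sum1 : \sum_i a i = 1.
Hypothesis K_le : forall i, (K i <= P)%N.
Hypothesis K_min : forall i, (K i0 <= K i)%N.
Hypothesis P_gt0 : (0 < P)%N.

Local Notation T := ('I_m * {set 'I_P})%type.
Local Notation ob := (@snd 'I_m {set 'I_P}).
Local Notation nu := (fun v : 'I_n => @vertex_law R m P a K).
Implicit Types (w : {ffun 'I_n -> T}) (s : seq 'I_n).

Let law0 := @law_ge0 R _ m P (fun _ : 'I_n => a) K (fun=> a_ge0).
Let law1 := @law_sum1 R _ m P (fun _ : 'I_n => a) K (fun=> a_sum1) K_le.

Definition component w s := chain ob w s && closed_off ob w s.

Lemma closed_off_eq w s s' : s =i s' -> closed_off ob w s = closed_off ob w s'.
Proof.
move=> ss; rewrite /closed_off.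
have -> : objects ob w s = objects ob w s'.
  by apply/setP => x; rewrite !inE; apply: eq_has_r.
by congr all; apply: eq_filter => v; rewrite ss.
Qed.

Lemma isolated_prob v :
  expect nu (fun w => (component w [:: v])%:R) <=
  expR (- ((n - 1)%:R * hit_prob P a K (K i0))).
Proof.
have := @component_prob R 'I_n m P a K a_ge0 a_sum1 K_le [:: v] (K i0) (hit_prob P a K (K i0)).
rewrite /= card_ord expr0 mul1r => /(_ isT isT) h.
have {}h := h ltac:(by rewrite hit_prob_ge0//=) ltac:(by rewrite mulr_ge0// hit_prob_ge0).
apply: le_trans h; apply: le_expect => // w wsup.
rewrite (_ : (K i0 <= _)%N = true)// objects_cons objects_nil finset.setU0.
by have [-> _] := @law_card R _ m P (fun _ : 'I_n => a) K v _ (wsup v); rewrite K_min.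
Qed.

(** Split according to whether the objects of [s] number at most [t]: [union_small] bounds one case,
    [component_prob] the other. *)
Lemma small_component_prob s (t : nat) (q0 : R) :
  uniq s -> (0 < size s)%N -> (t <= P)%N -> (t <= size s * K i0)%N ->
  0 <= q0 <= hit_prob P a K t.+1 -> (size s).-1%:R <= (n - size s)%:R * q0 ->
  expect nu (fun w => (component w s)%:R) <=
  expR t%:R * (t%:R / P%:R) ^+ (size s * K i0 - t) +
  q0 ^+ (size s).-1 * expR (- ((n - size s)%:R * q0)).
Proof.
move=> us s0 tP ts q0t sn; have sn' := sn; rewrite -[n in (n - _)%N]card_ord in sn'.
have := @component_prob R 'I_n m P a K a_ge0 a_sum1 K_le s t.+1 q0 us s0 q0t sn'.
rewrite card_ord => h.
have h' := @union_small R 'I_n m P (fun=> a) K (fun=> a_ge0) (fun=> a_sum1) K_le s t (K i0)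
  P_gt0 tP us (fun v i _ _ => K_min i) ts.
apply: le_trans (lerD h' h); rewrite -expectD; apply: le_expect => // w _.
by rewrite ltnNge /component; case: leqP => _; case: chain; case: closed_off; rewrite /= ?addr0 ?add0r.
Qed.

(** Components of size up to [r0] are counted as lists, since [chain] depends on the order of
    exploration. Larger ones are kept as vertex sets in a single event, which is later conditioned
    on the groups. *)
Lemma disconnected_le (r0 : nat) :
  1 - prob_connected n P a K <=
  \sum_(r < r0) \sum_(s : r.+1.-tuple 'I_n | uniq s) expect nu (fun w => (component w s)%:R) +
  Prob a K (fun w : outcome m n P => [exists S : {set 'I_n},
     [&& (r0 < #|S|)%N, (#|S| <= n./2)%N & closed_off ob w (enum S)]]).
Proof.
rewrite /prob_connected !Prob_expect.
have -> : 1 - expect nu (fun w => (connected_graph (Defs.adjacent w))%:R) =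
   expect nu (fun w => (~~ connected_graph (Defs.adjacent w))%:R).
  rewrite -[X in X - _](expect_cst law1) -mulN1r -expectZ -expectD.
  by apply: eq_expect => w; case: connected_graph; rewrite /= ?mulr1 ?subrr ?mulr0 ?addr0.
rewrite [X in X + _](_ : _ = expect nu (fun w =>
   \sum_(r < r0) \sum_(s : r.+1.-tuple 'I_n | uniq s) (component w s)%:R)); last first.
  by rewrite expect_sum; apply: eq_bigr => r _; rewrite expect_sum.
rewrite -expectD; apply: le_expect => // w _.
have S0 r : 0 <= \sum_(s : r.+1.-tuple 'I_n | uniq s) (component w s)%:R :> R by rewrite sumr_ge0.
case: (boolP (connected_graph _)) => /=.
  by move=> _; apply: addr_ge0 => //; apply: sumr_ge0 => r _; exact: S0.
move=> /disconnected_chain[s [us s0 sn cs cls]]; rewrite card_ord in sn.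
have [r0s|sr0] := ltnP r0 (size s).
  case: existsP => [_|[]]; first by rewrite lerDr; apply: sumr_ge0 => r _; exact: S0.
  exists [set v in s].
  have cS : #|[set v in s]| = size s by rewrite cardsE (card_uniqP us).
  rewrite cS r0s sn /= (@closed_off_eq _ _ s)// => v.
  by rewrite mem_enum inE.
have sr : ((size s).-1 < r0)%N by rewrite prednK.
rewrite (bigD1 (Ordinal sr))//= -addrA ler_wpDr//.
  by apply: addr_ge0 => //; apply: sumr_ge0 => r _; exact: S0.
have ss : size s == (size s).-1.+1 by rewrite prednK.
rewrite (bigD1 (Tuple ss))//= ler_wpDr ?sumr_ge0//.
by rewrite /component cs cls.
Qed.

(** Chernoff's bound with parameter 1: if [N] is the size of group [im], the mean of [expR (- N)] is
    a product over the vertices, and [1 - expR (-1) >= 1 / 2] bounds each factor by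
    [expR (- (a im / 2))]. *)
Lemma few_in_group_le (y : R) :
  \sum_(tau : {ffun 'I_n -> 'I_m} | #|[set v | tau v == im]|%:R < y) \prod_v a (tau v) <=
  expR (y - n%:R * a im / 2%:R).
Proof.
have e2 : 2^-1 <= 1 - expR (-1) :> R.
  have := @expR_ge1Dx R 1; rewrite expRN => h.
  have : (expR 1)^-1 <= 2^-1 :> R by rewrite lef_pV2 ?posrE ?expR_gt0//; lra.
  lra.
apply: (@le_trans _ _ (\sum_(tau : {ffun 'I_n -> 'I_m})
   expR y * \prod_v (a (tau v) * expR (- (tau v == im)%:R)))).
  rewrite big_mkcond; apply: ler_sum => tau _.
  have A0 : 0 <= \prod_v a (tau v) by apply: prodr_ge0.
  rewrite big_split/= mulrCA.
  case: ifP => [Ny|_]; last by rewrite !mulr_ge0 ?expR_ge0 ?prodr_ge0// => v _; exact: expR_ge0.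
  rewrite ler_peMr//.
  have -> : \prod_v expR (- (tau v == im)%:R) = expR (- #|[set v | tau v == im]|%:R) :> R.
    rewrite -expR_sum sumrN -sum1dep_card natr_sum [in RHS]big_mkcond.
    by congr (expR (- _)); apply: eq_bigr => v _; case: (tau v == im).
  by rewrite -expRD -[X in X <= _]expR0 ler_expR subr_ge0 ltW.
rewrite -mulr_sumr -(bigA_distr_bigA (fun (_ : 'I_n) i => a i * expR (- (i == im)%:R))) /=.
rewrite prodr_const card_ord expRD ler_wpM2l ?expR_ge0//.
have -> : expR (- (n%:R * a im / 2)) = expR (- (a im / 2)) ^+ n.
  by rewrite -expRM_natr; congr expR; ring.
rewrite lerXn2r ?nnegrE ?expR_ge0//.
  by rewrite sumr_ge0// => i _; rewrite mulr_ge0 ?expR_ge0.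
apply: le_trans (expR_ge1Dx _); rewrite (bigD1 im)//= eqxx.
rewrite (eq_bigr a); last by move=> i /negPf ->; rewrite oppr0 expR0 mulr1.
move: a_sum1; rewrite (bigD1 im)//= => aE.
have := a_ge0 im; nra.
Qed.

Section LargeComponents.
Variables (k T0 : nat).
Hypothesis T0_le : (T0 <= P)%N.

(** A threshold for union sizes: half of [c], capped so that it remains a small fraction of the
    pool. *)
Definition overlap (c : nat) : nat := minn (c./2) T0.

(* Bounds the probability that [c] objects in total, split into independent
   uniform sets, have a union of size at most [overlap c]. *)
Definition overlap_bound (c : nat) : R :=
  expR (overlap c)%:R * ((overlap c)%:R / P%:R) ^+ (c - overlap c).

(** Of [2 * k] members of group [im], at least [k] lie in [S] or at least [k] lie outside. Keep [k]
    of them as [Y]: there are no edges between [Y] and the complement of [S] in the first case, none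
    between [S] and [Y] in the second. The bound adds both cases. *)
Lemma large_component_prob (tau : {ffun 'I_n -> 'I_m}) (S : {set 'I_n}) :
  (2 * k <= #|[set v | tau v == im]|)%N ->
  expect (fun v => vertex_law (point_mass R tau v) K) (fun w => (closed_off ob w (enum S))%:R) <=
  overlap_bound (#|S| * K i0) +
    expR (- (k%:R * (K im)%:R * (overlap (#|S| * K i0)).+1%:R / P%:R)) +
  (overlap_bound (k * K im) +
    expR (- ((n - #|S|)%:R * (K i0)%:R * (overlap (k * K im)).+1%:R / P%:R))).
Proof.
set A := [set v | _] => kA.
have ob0 c : 0 <= overlap_bound c by rewrite mulr_ge0 ?expR_ge0// exprn_ge0// divr_ge0.
have nu0 := @law_ge0 R _ m P (point_mass R tau) K (point_mass_ge0 R tau).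
have noedge (X Y : {set 'I_n}) (kap lam : nat) :
    [disjoint X & Y] -> (forall v, v \in X -> (kap <= K (tau v))%N) ->
    (forall v, v \in Y -> (lam <= K (tau v))%N) ->
    (forall w, closed_off ob w (enum S) ->
       all (fun v => misses ob (objects ob w (enum X)) (w v)) (enum Y)) ->
    expect (fun v => vertex_law (point_mass R tau v) K) (fun w => (closed_off ob w (enum S))%:R) <=
    overlap_bound (#|X| * kap) +
    expR (- (#|Y|%:R * lam%:R * (overlap (#|X| * kap)).+1%:R / P%:R)).
  move=> XY kX lY clos.
  have point_massK v i : point_mass R tau v i != 0 -> i = tau v.
    by rewrite /point_mass; have [//|_] := eqVneq i (tau v); rewrite eqxx.
  have us := @union_small R 'I_n m P (point_mass R tau) K (point_mass_ge0 R tau) (@point_mass_sum1 R _ _ tau) K_le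
    (enum X) (overlap (#|X| * kap)) kap P_gt0.
  rewrite -cardE in us.
  have {us} us := us (leq_trans (geq_minr _ _) T0_le) (enum_uniq _).
  have {}us := us ltac:(move=> v i; rewrite mem_enum => vX /point_massK ->; exact: kX).
  have {}us := us ltac:(apply: leq_trans (geq_minl _ _) _; lia).
  have := @no_edge_prob R 'I_n m P (point_mass R tau) K (point_mass_ge0 R tau) (@point_mass_sum1 R _ _ tau) K_le P_gt0
    (enum X) (enum Y) (overlap (#|X| * kap)) lam (enum_uniq _).
  rewrite -cardE => ne.
  have {}ne := ne ltac:(move=> v; rewrite !mem_enum => vY; apply/negP => vX;
    by move: XY => /pred0P/(_ v); rewrite /= vX vY).
  have {}ne := ne ltac:(move=> v i; rewrite mem_enum => vY /point_massK ->; exact: lY).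
  apply: (le_trans _ (le_trans ne (lerD us (lexx _)))).
  apply: le_expect => // w _; have := clos w.
  by case: closed_off => // ->.
have clos (X Y : {set 'I_n}) : X \subset S -> Y \subset ~: S -> forall w,
    closed_off ob w (enum S) ->
    all (fun v => misses ob (objects ob w (enum X)) (w v)) (enum Y).
  move=> XS YS w /allP cl; apply/allP => v; rewrite mem_enum => vY.
  have /missesP vm : misses ob (objects ob w (enum S)) (w v).
    apply: cl; rewrite mem_filter mem_enum mem_enum andbT.
    by move/fintype.subsetP/(_ v vY): YS; rewrite inE.
  apply/missesP => x /vm; apply: contra; apply/fintype.subsetP/objects_sub.
  by move=> z; rewrite !mem_enum; apply/fintype.subsetP.
have disj (X Y : {set 'I_n}) : X \subset S -> Y \subset ~: S -> [disjoint X & Y].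
  move=> XS YS; rewrite finset.disjoints_subset; apply: fintype.subset_trans XS _.
  by rewrite -finset.setCS finset.setCK.
have pick (X : {set 'I_n}) : (k <= #|X|)%N -> exists2 Y : {set 'I_n}, Y \subset X & #|Y| = k.
  move=> kX; have : (0 < #|[set B : {set 'I_n} | B \subset X & #|B| == k]|)%N.
    by rewrite cards_draws bin_gt0.
  by case/card_gt0P => Y; rewrite inE => /andP[YX /eqP Yk]; exists Y.
have : (k <= #|A :&: S| \/ k <= #|A :\: S|)%N.
  by move: kA; rewrite -(cardsID S A); move: #|_| #|_| => x y; lia.
case=> /pick[Y YA Yk].
  have [YA' YS] : Y \subset A /\ Y \subset S by apply/andP; rewrite -finset.subsetI.
  apply: (le_trans (noedge Y (~: S) (K im) (K i0) _ _ _ _)).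
  - exact: disj.
  - by move=> v /(fintype.subsetP YA'); rewrite inE => /eqP ->.
  - by move=> v _.
  - exact: clos.
  rewrite Yk cardsCs finset.setCK card_ord lerDr addr_ge0 ?expR_ge0//.
have [YA' YS] : Y \subset A /\ Y \subset ~: S.
  by move: YA; rewrite finset.setDE finset.subsetI => /andP.
apply: (le_trans (noedge S Y (K i0) (K im) _ _ _ _)).
- exact: disj.
- by move=> v _.
- by move=> v /(fintype.subsetP YA'); rewrite inE => /eqP ->.
- exact: clos.
by rewrite Yk lerDl addr_ge0 ?expR_ge0.
Qed.

(** Assignments with fewer than [y] vertices in group [im] are paid for by [few_in_group_le]. Under
    the others, a union bound over the sets [S], sorted by size, applies [large_component_prob]. *)
Lemma large_components_le (r0 : nat) (y : R) (f : nat -> R) :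
  (forall N : nat, y <= N%:R -> (2 * k <= N)%N) ->
  (forall r, (r0 < r)%N -> (r <= n./2)%N ->
    'C(n, r)%:R * (overlap_bound (r * K i0) +
    expR (- (k%:R * (K im)%:R * (overlap (r * K i0)).+1%:R / P%:R)) +
  (overlap_bound (k * K im) +
    expR (- ((n - r)%:R * (K i0)%:R * (overlap (k * K im)).+1%:R / P%:R)))) <= f r) ->
  (forall r, 0 <= f r) ->
  Prob a K (fun w : outcome m n P => [exists S : {set 'I_n},
     [&& (r0 < #|S|)%N, (#|S| <= n./2)%N & closed_off ob w (enum S)]]) <=
  expR (y - n%:R * a im / 2%:R) + \sum_(r < n.+1 | (0 < r)%N) f r.
Proof.
move=> yk fE f0; rewrite Prob_condition.
rewrite (bigID (fun tau : {ffun 'I_n -> 'I_m} => #|[set v | tau v == im]|%:R < y)) /=.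
have A0 (tau : {ffun 'I_n -> 'I_m}) : 0 <= \prod_v a (tau v) by apply: prodr_ge0.
have nu0 (tau : {ffun 'I_n -> 'I_m}) := @law_ge0 R _ m P (point_mass R tau) K (point_mass_ge0 R tau).
have nu1 (tau : {ffun 'I_n -> 'I_m}) :=
  @law_sum1 R _ m P (point_mass R tau) K (@point_mass_sum1 R _ _ tau) K_le.
apply: lerD.
  apply: le_trans (few_in_group_le y); apply: ler_sum => tau _.
  rewrite ler_piMr//; rewrite -[X in _ <= X](expect_cst (nu1 tau)).
  by apply: le_expect => // w _; rewrite lern1 leq_b1.
apply: (@le_trans _ _ (\sum_(tau : {ffun 'I_n -> 'I_m}) (\prod_v a (tau v)) *
   \sum_(r < n.+1 | (0 < r)%N) f r)); last first.
  rewrite -mulr_suml -(bigA_distr_bigA (fun (_ : 'I_n) i => a i)) /=.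
  by rewrite prodr_const a_sum1 expr1n mul1r.
have F0 : 0 <= \sum_(r < n.+1 | (0 < r)%N) f r by rewrite sumr_ge0.
rewrite big_mkcond; apply: ler_sum => tau _; case: ifP => [|_]; last by rewrite mulr_ge0.
rewrite -leNgt => /yk kA; rewrite ler_wpM2l//.
pose Q (S : {set 'I_n}) := (r0 < #|S|)%N && (#|S| <= n./2)%N.
apply: (@le_trans _ _ (\sum_(S : {set 'I_n} | Q S)
   expect (fun v => vertex_law (point_mass R tau v) K) (fun w => (closed_off ob w (enum S))%:R))).
  rewrite -expect_sum; apply: le_expect => // w _.
  case: existsP => [[S /and3P[h1 h2 h3]]|_] /=; last by rewrite sumr_ge0.
  by rewrite (bigD1 S) /Q ?h1 ?h2//= h3 lerDl sumr_ge0.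
rewrite (partition_big (fun S : {set 'I_n} => inord #|S| : 'I_n.+1) (fun r : 'I_n.+1 => (0 < r)%N)); last first.
  by move=> S /andP[h _]; rewrite inordK ?ltnS ?(leq_ltn_trans _ h)//; have := max_card S; rewrite card_ord.
apply: ler_sum => r r_gt0.
have cS (S : {set 'I_n}) : (inord #|S| == r :> 'I_n.+1) = (#|S| == r).
  by rewrite -val_eqE /= inordK// ltnS; have := max_card S; rewrite card_ord.
case: (boolP ((r0 < r)%N && (r <= n./2)%N)) => [/andP[rr rn]|hr]; last first.
  by rewrite big1// => S; rewrite cS => /andP[QS /eqP Sr]; move: hr; rewrite -Sr -/(Q S) QS.
apply: le_trans (fE r rr rn).
set B := (X in _ * X).
apply: (@le_trans _ _ (\sum_(S : {set 'I_n} | #|S| == r) B)); last first.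
  by rewrite sumr_const -cardsE card_draws card_ord -[X in X <= _]mulr_natl.
rewrite big_mkcond [X in _ <= X]big_mkcond; apply: ler_sum => S _; rewrite cS.
have [Sr|_] := eqVneq #|S| r; last by rewrite andbF.
rewrite andbT; case: ifP => _.
  by apply: le_trans (large_component_prob _ kA) _; rewrite Sr.
by rewrite /B !addr_ge0 ?expR_ge0 ?mulr_ge0 ?exprn_ge0 ?expR_ge0 ?divr_ge0.
Qed.

End LargeComponents.
End UnionBound.

(** * Large components *)

Lemma geometric_le (R : realFieldType) (y : R) (N : nat) :
  0 <= y <= 2^-1 -> \sum_(r < N) y ^+ r.+1 <= 2 * y.
Proof.
move=> /andP[y0 y2].
(* The extra term dominates the tail of the series when [y <= 1 / 2], which makes the claim
   inductive. *)
suff : \sum_(r < N) y ^+ r.+1 + 2 * y ^+ N.+1 <= 2 * y.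
  by apply: le_trans; rewrite lerDl mulr_ge0// exprn_ge0.
elim: N => [|N IHN]; first by rewrite big_ord0 add0r expr1.
rewrite big_ord_recr/= -addrA; apply: le_trans IHN; rewrite lerD2l.
by rewrite [y ^+ N.+2]exprS; have := exprn_ge0 N.+1 y0; nra.
Qed.

Lemma expR1_le4 (R : realType) : expR 1 <= 4 :> R.
Proof.
have h := @expR_ge1Dx R (- 2^-1).
have e : expR (- 2^-1) * expR (- 2^-1) * expR 1 = 1 :> R.
  by rewrite -!expRD -[RHS]expR0; congr expR; lra.
have e2 : 4^-1 <= expR (- 2^-1) * expR (- 2^-1) :> R.
  by have -> : 4^-1 = 2^-1 * 2^-1 :> R; [lra | rewrite ler_pM//; lra].
have : 4^-1 * expR 1 <= 1 :> R by rewrite -[X in _ <= X]e ler_wpM2r ?expR_ge0.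
lra.
Qed.

Lemma expR_nat_le4 (R : realType) k : expR k%:R <= 4 ^+ k :> R.
Proof.
by rewrite -[k%:R]mul1r expRM_natr lerXn2r ?nnegrE ?expR_ge0// expR1_le4.
Qed.

Lemma bin_le_div (R : realType) n r : (0 < r)%N -> (0 < n)%N ->
  'C(n, r)%:R <= (4 * (n%:R / r%:R)) ^+ r :> R.
Proof.
move=> r0 n0; have := le_trans (bin_le_expR R r n0) (expR_nat_le4 R r).
move=> h; rewrite exprMn -[n%:R / _]invf_div exprVn ler_pdivlMr//.
by rewrite exprn_gt0// divr_gt0 ?ltr0n.
Qed.

Lemma bin_le_exp (R : realType) n r : 'C(n, r)%:R <= expR n%:R :> R.
Proof. by have := @bin_mul_expr_le R n r 1 ler01; rewrite expr1n !mulr1. Qed.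

(** * Overlap bounds with the cap at a sixteenth of the pool *)

Section Overlap.
Variables (R : realType) (P : nat).
Hypothesis P_gt0 : (0 < P)%N.
Let T0 := (P %/ 16)%N.
Let PR : R := P%:R.

Lemma overlap_share c : (overlap T0 c)%:R / PR <= 16^-1.
Proof.
rewrite ler_pdivrMr ?ltr0n// mulrC ler_pdivlMr// -natrM ler_nat.
by apply: leq_trans (leq_trunc_div P 16); rewrite leq_mul2r geq_minr.
Qed.

Lemma overlap_half c : (2 * overlap T0 c <= c)%N.
Proof. by rewrite /overlap; have := geq_minl c./2 T0; lia. Qed.

(** The successor makes up for the rounding in [c./2] and in [P %/ 16]. *)
Lemma overlapS_ge c :
  c%:R / 2 <= (overlap T0 c).+1%:R :> R \/ PR / 16 <= (overlap T0 c).+1%:R.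
Proof.
have [h|h] := leqP c./2 T0; [left|right].
  by rewrite /overlap (minn_idPl h) ler_pdivrMr// -natrM ler_nat; lia.
rewrite /overlap (minn_idPr (ltnW h)) ler_pdivrMr// /PR -natrM ler_nat /T0.
by rewrite ltnW// ltn_ceil.
Qed.

(** The overlap is at most [c - overlap T0 c], so [expR] of it is absorbed by one factor 4 per
    power; the base is then at most [1 / 4], and the exponent may be lowered to [d]. *)
Lemma overlap_bound_le c d : (2 * d <= c)%N ->
  overlap_bound R P T0 c <= (4 * ((overlap T0 c)%:R / PR)) ^+ d.
Proof.
move=> dc; rewrite /overlap_bound -/PR; set o := overlap T0 c; set y := o%:R / PR.
have y0 : 0 <= y by rewrite divr_ge0.
have y1 : 4 * y <= 1 by have := overlap_share c; rewrite -/o -/y; lra.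
have oc := overlap_half c; rewrite -/o in oc.
apply: (@le_trans _ _ (4 ^+ (c - o) * y ^+ (c - o))).
  rewrite ler_wpM2r ?exprn_ge0//; apply: le_trans (expR_nat_le4 R o) _.
  by rewrite ler_eXn2l ?ltr1n//; lia.
have dco : (d <= c - o)%N by lia.
by rewrite -exprMn; apply: ler_wiXn2l => //; rewrite mulr_ge0.
Qed.

Lemma overlap_bound_le_expR c : (1 < c)%N ->
  overlap_bound R P T0 c <= expR (- (c%:R / 4)).
Proof.
move=> c1; have dc : (2 * c./2 <= c)%N by lia.
apply: le_trans (overlap_bound_le dc) _.
apply: (@le_trans _ _ ((expR (-1)) ^+ c./2)).
  have h1 := expR1_le4 R; have h2 := overlap_share c.
  have h3 : 0 <= 4 * ((overlap T0 c)%:R / PR) by rewrite mulr_ge0// divr_ge0.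
  rewrite lerXn2r ?nnegrE ?expR_ge0//.
  apply: (@le_trans _ _ 4^-1); first by lra.
  by rewrite expRN lef_pV2 ?posrE ?expR_gt0.
rewrite -expRM_natr ler_expR mulN1r lerN2.
by rewrite ler_pdivrMr// -natrM ler_nat; lia.
Qed.

End Overlap.

Lemma double_half_pred_le k : (1 < k)%N -> (2 * (k./2.-1).+1 <= k <= 2 * (k./2.-1).+1 + 1)%N.
Proof. by move=> k1; apply/andP; split; lia. Qed.

Section LargeTerms.
Variables (R : realType) (n P kap lam k r : nat) (A L c0 : R).
(** The mean number of objects shared by two independent uniform sets of sizes [kap] and [lam]. *)
Let D : R := kap%:R * lam%:R / P%:R.
Let T0 := (P %/ 16)%N.
Let g : R := A / 64.
Hypothesis n_gt0 : (0 < n)%N.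
Hypothesis P_gt0 : (0 < P)%N.
Hypothesis nE : n%:R = expR L :> R.
Hypothesis c0_gt0 : 0 < c0.
Hypothesis nP : c0 * n%:R <= P%:R.
Hypothesis A01 : 0 < A <= 1.
Hypothesis nA : n%:R * A / 16 <= k%:R :> R.
Hypothesis kap_le : (kap <= lam)%N.
Hypothesis r_gt0 : (0 < r)%N.
Hypothesis rn : (2 * r <= n)%N.
Hypothesis LD : L <= n%:R * D.
Hypothesis Akap : 256 <= A * kap%:R.
Hypothesis AL : 64 <= A * L.

Let n0 : 0 < n%:R :> R. Proof. by rewrite ltr0n. Qed.
Let P0 : 0 < P%:R :> R. Proof. by rewrite ltr0n. Qed.
Let r0 : 0 < r%:R :> R. Proof. by rewrite ltr0n. Qed.
Let kap2 : (1 < kap)%N.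
Proof.
have : A * kap%:R <= 1 * kap%:R by rewrite ler_wpM2r//; case/andP: A01.
have := Akap => h1 h2; have : 2 <= kap%:R :> R by lra.
by rewrite ler_nat.
Qed.
Let rn' : r%:R <= n%:R / 2 :> R.
Proof. by rewrite ler_pdivlMr// -natrM ler_nat mulnC. Qed.

(* One factor of [overlap / P <= r * kap / (2 * c0 * n)] cancels [n / r] from the
   number of sets; the others are at most [1 / 4] and absorb [kap]. *)
Lemma large_term_overlap :
  'C(n, r)%:R * overlap_bound R P T0 (r * kap) <=
  (64 / c0 * (kap%:R * 2^-1 ^+ kap)) ^+ r.
Proof.
pose h := (kap./2.-1)%N; pose y : R := (overlap T0 (r * kap))%:R / P%:R.
have y0 : 0 <= y by rewrite divr_ge0.
have y1 : 4 * y <= 4^-1 by have := overlap_share R P_gt0 (r * kap); rewrite -/y; lra.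
have yr : y <= r%:R * kap%:R / (2 * c0 * n%:R).
  rewrite ler_pdivrMr// mulrAC ler_pdivlMr ?mulr_gt0//.
  have : 2 * (overlap T0 (r * kap))%:R <= r%:R * kap%:R :> R.
    by rewrite -!natrM ler_nat overlap_half.
  move=> h2; rewrite (_ : _ * (2 * _ * _) = 2 * (overlap T0 (r * kap))%:R * (c0 * n%:R)); last by ring.
  by rewrite ler_pM// mulr_ge0// ltW.
have /andP[hk hk'] : (2 * h.+1 <= kap <= 2 * h.+1 + 1)%N by apply: double_half_pred_le kap2.
have rh : (2 * (r * h.+1) <= r * kap)%N by rewrite mulnCA leq_mul2l hk orbT.
have ob := overlap_bound_le R P_gt0 rh; rewrite -/T0 -/y in ob.
have ob0 : 0 <= overlap_bound R P T0 (r * kap).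
  by rewrite mulr_ge0 ?expR_ge0// exprn_ge0.
apply: (@le_trans _ _ ((4 * (n%:R / r%:R)) ^+ r * (4 * y) ^+ (r * h.+1))).
  by apply: ler_pM => //; exact: bin_le_div.
rewrite mulnC exprM -exprMn lerXn2r ?nnegrE//.
- by rewrite mulr_ge0 ?exprn_ge0 ?mulr_ge0// divr_ge0.
- by rewrite mulr_ge0 ?mulr_ge0 ?exprn_ge0 ?invr_ge0// ltW.
have yh : (4 * y) ^+ h <= 8 * 2^-1 ^+ kap.
  apply: (@le_trans _ _ (4^-1 ^+ h)); first by rewrite lerXn2r ?nnegrE ?mulr_ge0.
  have -> : 4^-1 = 2^-1 ^+ 2 :> R by rewrite expr2; lra.
  rewrite -exprM; have -> : 8 = 2^-1 ^- 3 :> R by rewrite exprVn invrK -natrX.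
  rewrite ler_pdivlMl ?exprn_gt0// -exprD ler_wiXn2l//; first by lra.
  by apply: leq_trans hk' _; rewrite mulnS addn1.
have -> : 64 / c0 * (kap%:R * 2^-1 ^+ kap) =
  4 * (n%:R / r%:R) * (4 * (r%:R * kap%:R / (2 * c0 * n%:R)) * (8 * 2^-1 ^+ kap)) :> R.
  by field; rewrite !gt_eqF.
rewrite ler_wpM2l ?mulr_ge0 ?divr_ge0// exprS ler_pM ?mulr_ge0 ?exprn_ge0 ?mulr_ge0//.
by rewrite ler_wpM2l.
Qed.

(** All subsets are counted crudely by [expR n]; as [r <= n], the surplus [n * (y - 1)] in the
    exponent is at least [r * (y - 1)]. *)
Let exp_count (x y : R) : 1 <= y -> n%:R * y <= x ->
  'C(n, r)%:R * expR (- x) <= expR (1 - y) ^+ r.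
Proof.
move=> y1 h; apply: le_trans (ler_wpM2r (expR_ge0 _) (bin_le_exp R n r)) _.
rewrite -expRD -expRM_natr ler_expR.
have rn2 : r%:R <= n%:R :> R by move: n0 rn' => *; lra.
nra.
Qed.

Let exp_count_kap (x : R) : n%:R * (A * kap%:R / 16 / 16) <= x ->
  'C(n, r)%:R * expR (- x) <= expR (1 - A * kap%:R / 16 / 16) ^+ r.
Proof. by apply: exp_count; have := Akap; lra. Qed.

Let kap_le' : kap%:R <= lam%:R :> R. Proof. by rewrite ler_nat. Qed.
Let k0 : 0 < k%:R :> R.
Proof. by apply: lt_le_trans nA; case/andP: A01 => h1 _; rewrite !divr_gt0 ?mulr_gt0. Qed.

(** Without the cap, the exponent is at least [r * A * L / 32], twice the [r * g * L] coming from
    the count [(4 * n / r) ^+ r]. With the cap it is at least [n * A * kap / 256], and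
    [exp_count_kap] applies. *)
Lemma large_term_hit : expR ((1 - g) * L) <= r%:R ->
  'C(n, r)%:R * expR (- (k%:R * lam%:R * (overlap T0 (r * kap)).+1%:R / P%:R)) <=
  (4 * expR (- (A / 64 * L))) ^+ r + expR (1 - A * kap%:R / 16 / 16) ^+ r.
Proof.
move=> rg; case/andP: A01 => A0 A1.
have kl : n%:R * A / 16 * kap%:R <= k%:R * lam%:R.
  by rewrite ler_pM ?divr_ge0 ?mulr_ge0// ltW.
case: (overlapS_ge R P_gt0 (r * kap)) => h.
  rewrite ler_wpDr ?exprn_ge0 ?expR_ge0//.
  apply: (@le_trans _ _ ((4 * expR (g * L)) ^+ r * expR (- (A / 32 * L)) ^+ r)).
    apply: ler_pM => //.
      apply: le_trans (bin_le_div R r_gt0 n_gt0) _.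
      rewrite lerXn2r ?nnegrE ?mulr_ge0 ?divr_ge0 ?expR_ge0// ler_wpM2l//.
      rewrite ler_pdivrMr// nE; have -> : L = g * L + (1 - g) * L by ring.
      by rewrite expRD [X in _ <= expR X * _](_ : _ = g * L) ?ler_wpM2l ?expR_ge0//; ring.
    rewrite -expRM_natr ler_expR mulNr lerN2 natrM in h *.
    apply: (@le_trans _ _ (k%:R * lam%:R * (r%:R * kap%:R / 2) / P%:R)); last first.
      by rewrite ler_wpM2r ?invr_ge0// ler_wpM2l// mulr_ge0.
    have -> : k%:R * lam%:R * (r%:R * kap%:R / 2) / P%:R = k%:R * D * (r%:R / 2) :> R.
      by rewrite /D; field; rewrite gt_eqF.
    have D0 : 0 <= D by rewrite divr_ge0 ?mulr_ge0.
    have : A / 16 * L <= k%:R * D.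
      apply: (@le_trans _ _ (A / 16 * (n%:R * D))); first by rewrite ler_wpM2l ?divr_ge0// ltW.
      by rewrite (_ : A / 16 * (n%:R * D) = n%:R * A / 16 * D) ?ler_wpM2r//; ring.
    by move=> AkD; have := ler_wpM2r (ltW r0) AkD; lra.
  rewrite -exprMn (_ : 4 * _ * _ = 4 * expR (g * L - A / 32 * L)); last by rewrite expRD mulrA.
  rewrite lerXn2r ?nnegrE ?mulr_ge0 ?expR_ge0// ler_wpM2l// ler_expR /g; lra.
rewrite ler_wpDl ?exprn_ge0 ?mulr_ge0 ?expR_ge0//; apply: exp_count_kap.
apply: (@le_trans _ _ (k%:R * lam%:R * (P%:R / 16) / P%:R)); last first.
  by rewrite ler_wpM2r ?invr_ge0// ler_wpM2l// mulr_ge0.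
rewrite (_ : _ * _ / _ = k%:R * lam%:R / 16); last by field; rewrite gt_eqF.
by lra.
Qed.

Lemma large_term_overlap_max :
  'C(n, r)%:R * overlap_bound R P T0 (k * lam) <= expR (1 - A * kap%:R / 16 / 16) ^+ r.
Proof.
case/andP: A01 => A0 A1.
have kl : n%:R * A / 16 * kap%:R <= k%:R * lam%:R.
  by rewrite ler_pM ?divr_ge0 ?mulr_ge0// ltW.
have k1 : (0 < k)%N by rewrite -(ltr0n R).
have kl1 : (1 < k * lam)%N by apply: leq_trans (leq_trans kap2 kap_le) _; rewrite leq_pmull.
apply: le_trans (ler_wpM2l _ (overlap_bound_le_expR R P_gt0 kl1)) _ => //.
apply: exp_count_kap; rewrite natrM; have : 0 <= n%:R * A * kap%:R by rewrite !mulr_ge0// ltW.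
lra.
Qed.

(** Here [n - r >= n / 2], so the exponent is linear in [n] in both cases: at least [n * A * L / 64]
    without the cap and [n * kap / 32] with it. *)
Lemma large_term_hit_max :
  'C(n, r)%:R * expR (- ((n - r)%:R * kap%:R * (overlap T0 (k * lam)).+1%:R / P%:R)) <=
  expR (1 - A * L / 64) ^+ r + expR (1 - A * kap%:R / 16 / 16) ^+ r.
Proof.
case/andP: A01 => A0 A1.
have nr : n%:R / 2 <= (n - r)%:R :> R.
  have rn2 : (r <= n)%N by apply: leq_trans rn; rewrite mul2n -addnn leq_addr.
  by rewrite natrB//; have h1 := n0; have h2 := rn'; lra.
case: (overlapS_ge R P_gt0 (k * lam)) => h.
  rewrite ler_wpDr ?exprn_ge0 ?expR_ge0//; apply: exp_count.
    by have := AL; lra.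
  apply: (@le_trans _ _ (n%:R / 2 * kap%:R * (k%:R * lam%:R / 2) / P%:R)); last first.
    rewrite natrM in h; rewrite ler_wpM2r ?invr_ge0// ler_pM// ?mulr_ge0 ?divr_ge0 ?mulr_ge0//.
    by rewrite ler_wpM2r.
  have -> : n%:R / 2 * kap%:R * (k%:R * lam%:R / 2) / P%:R = n%:R / 4 * (k%:R * D) :> R.
    by rewrite /D; field; rewrite gt_eqF.
  have D0 : 0 <= D by rewrite divr_ge0 ?mulr_ge0.
  have kD : A / 16 * L <= k%:R * D.
    apply: (@le_trans _ _ (A / 16 * (n%:R * D))); first by rewrite ler_wpM2l ?divr_ge0// ltW.
    by rewrite (_ : A / 16 * (n%:R * D) = n%:R * A / 16 * D) ?ler_wpM2r//; ring.
  have n4 : 0 <= n%:R / 4 :> R by rewrite divr_ge0.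
  by have := ler_wpM2l n4 kD; lra.
rewrite ler_wpDl ?exprn_ge0 ?expR_ge0//; apply: exp_count_kap.
apply: (@le_trans _ _ (n%:R / 2 * kap%:R * (P%:R / 16) / P%:R)); last first.
  rewrite ler_wpM2r ?invr_ge0// ler_pM// ?mulr_ge0 ?divr_ge0//.
  by rewrite ler_wpM2r.
rewrite ler_pdivlMr//.
have nkP : 0 <= n%:R * kap%:R * P%:R :> R by rewrite !mulr_ge0.
have := ler_wpM2r nkP A1; lra.
Qed.

Lemma large_term_le : expR ((1 - g) * L) <= r%:R ->
  'C(n, r)%:R * (overlap_bound R P T0 (r * kap) +
    expR (- (k%:R * lam%:R * (overlap T0 (r * kap)).+1%:R / P%:R)) +
  (overlap_bound R P T0 (k * lam) +
    expR (- ((n - r)%:R * kap%:R * (overlap T0 (k * lam)).+1%:R / P%:R)))) <=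
  (64 / c0 * (kap%:R * 2^-1 ^+ kap)) ^+ r + (4 * expR (- (A / 64 * L))) ^+ r +
  expR (1 - A * L / 64) ^+ r + 3 * expR (1 - A * kap%:R / 16 / 16) ^+ r.
Proof.
move=> rg; rewrite !mulrDr.
have h1 := large_term_overlap; have h2 := large_term_hit rg.
have h3 := large_term_overlap_max; have h4 := large_term_hit_max.
lra.
Qed.

End LargeTerms.

(** * Small components *)

Section EdgeDensity.
Variables (R : realType) (m P : nat) (a : 'I_m -> R) (K : 'I_m -> nat) (im : 'I_m).
Hypothesis a_ge0 : forall i, 0 <= a i.
Hypothesis a_sum1 : \sum_i a i = 1.
Hypothesis K_range : forall i, (0 < K i <= P)%N.
Hypothesis K_max : forall i, (K i <= K im)%N.
Hypothesis P_gt0 : (0 < P)%N.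
Let K_le i : (K i <= P)%N. Proof. by case/andP: (K_range i). Qed.
Let P0 : 0 < P%:R :> R. Proof. by rewrite ltr0n. Qed.

Lemma hit_prob_le_degree (u : nat) : (u <= P)%N ->
  hit_prob P a K u <= \sum_i a i * (u%:R * (K i)%:R / P%:R).
Proof.
move=> uP; apply: ler_sum => i _; rewrite ler_wpM2l//.
by have := rho_ge R uP (K_range i); lra.
Qed.

Lemma degree_le (u : R) : 0 <= u ->
  \sum_i a i * (u * (K i)%:R / P%:R) <= u * (K im)%:R / P%:R.
Proof.
move=> u0; rewrite -[X in _ <= X]mul1r -[X in _ <= X * _]a_sum1 mulr_suml.
apply: ler_sum => i _; rewrite ler_wpM2l// ler_wpM2r ?invr_ge0//.
by rewrite ler_wpM2l// ler_nat.
Qed.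

Let one_sub_expR (z : R) : 0 <= z -> z / (1 + z) <= 1 - expR (- z).
Proof.
move=> z0; have z1 : 0 < 1 + z by lra.
have : expR (- z) <= (1 + z)^-1 by rewrite expRN lef_pV2 ?posrE ?expR_gt0// expR_ge1Dx.
have -> : z / (1 + z) = 1 - (1 + z)^-1 by field; rewrite gt_eqF.
lra.
Qed.

(** For [0 <= z <= eta], [1 - expR (- z) >= z / (1 + z) >= (1 - eta) * z]: small hit probabilities
    are almost linear in the number of objects. The real [x] leaves room for rounding [u]. *)
Lemma hit_prob_ge_degree (u : nat) (x eta : R) :
  0 <= x <= u%:R -> 0 <= eta <= 1 -> x * (K im)%:R / P%:R <= eta ->
  (1 - eta) * (\sum_i a i * (x * (K i)%:R / P%:R)) <= hit_prob P a K u.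
Proof.
move=> /andP[x0 xu] /andP[e0 e1] xe; rewrite mulr_sumr; apply: ler_sum => i _.
rewrite mulrCA ler_wpM2l//; set z := x * _ / _.
have z0 : 0 <= z by rewrite divr_ge0 ?mulr_ge0.
have ze : z <= eta.
  by apply: le_trans xe; rewrite ler_wpM2r ?invr_ge0// ler_wpM2l// ler_nat.
have h1 : rho R P (K i) u <= expR (- z).
  apply: le_trans (rho_le_expR R u P_gt0 (K_le i)) _.
  by rewrite ler_expR lerN2 !ler_wpM2r ?invr_ge0.
have h2 := one_sub_expR z0.
have : (1 - eta) * z <= z / (1 + z) by rewrite ler_pdivlMr; [nra | lra].
lra.
Qed.

(** Only the term of group [im] is kept. At [u = K i0] this makes the edge probability comparable
    with [K i0 * K im / P]. *)
Lemma hit_prob_ge_max (u : nat) : u%:R * (K im)%:R <= P%:R :> R ->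
  a im * (u%:R * (K im)%:R / P%:R) <= 2 * hit_prob P a K u.
Proof.
move=> uP; set z := _ / _.
have z0 : 0 <= z by rewrite divr_ge0 ?mulr_ge0.
have z1 : z <= 1 by rewrite ler_pdivrMr// mul1r.
have h1 := rho_le_expR R u P_gt0 (K_le im); rewrite -/z in h1.
have h2 := one_sub_expR z0.
have h3 : z / 2 <= z / (1 + z).
  by rewrite ler_wpM2l// lef_pV2 ?posrE; lra.
have h4 : a im * (1 - rho R P (K im) u) <= hit_prob P a K u.
  rewrite /hit_prob (bigD1 im)//= lerDl sumr_ge0// => i _.
  by rewrite mulr_ge0// subr_ge0 rho_le1.
have : a im * (z / 2) <= a im * (1 - rho R P (K im) u) by rewrite ler_wpM2l//; lra.
lra.
Qed.

End EdgeDensity.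

(** * Lists of between two and [n^(1-g)] vertices *)

Section SmallTerms.
Variables (R : realType) (m n P : nat) (a : 'I_m -> R) (K : 'I_m -> nat) (i0 im : 'I_m).
Variables (A L b c0 g : R) (r : nat).
Hypothesis a_ge0 : forall i, 0 <= a i.
Hypothesis a_sum1 : \sum_i a i = 1.
Hypothesis K_range : forall i, (0 < K i <= P)%N.
Hypothesis K_min : forall i, (K i0 <= K i)%N.
Hypothesis K_max : forall i, (K i <= K im)%N.
Hypothesis P_gt0 : (0 < P)%N.
Local Notation kap := (K i0).
Local Notation lam := (K im).
Let D : R := kap%:R * lam%:R / P%:R.
Hypothesis nE : n%:R = expR L :> R.
Hypothesis c0_gt0 : 0 < c0.
Hypothesis nP : c0 * n%:R <= P%:R.
Hypothesis A01 : 0 < A <= 1.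
Hypothesis g01 : 0 < g <= 1.
Hypothesis Lb : L <= n%:R * b <= 2 * L.
Hypothesis bE : b = hit_prob P a K kap.
Hypothesis AD : A * D <= 2 * b.
Hypothesis hL1 : 4 * L / A <= g / 16 * expR (g * L).
Hypothesis hL2 : 4 * L / (A * c0) <= expR (g * L).
Hypothesis hL3 : 2 * L <= expR (g / 16 * L).
Hypothesis hL4 : 32 <= g ^+ 2 * L.
Hypothesis hkap : 64 <= g ^+ 2 * kap%:R.
Hypothesis r_gt1 : (1 < r)%N.
Hypothesis rg : r%:R <= expR ((1 - g) * L).

Let K_le i : (K i <= P)%N. Proof. by case/andP: (K_range i). Qed.
Let P0 : 0 < P%:R :> R. Proof. by rewrite ltr0n. Qed.
Let n0 : 0 < n%:R :> R. Proof. by rewrite nE expR_gt0. Qed.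
Let A0 : 0 < A. Proof. by case/andP: A01. Qed.
Let A1 : A <= 1. Proof. by case/andP: A01. Qed.
Let g0 : 0 < g. Proof. by case/andP: g01. Qed.
Let g1 : g <= 1. Proof. by case/andP: g01. Qed.
Let L32 : 32 <= L.
Proof.
have g2 : g ^+ 2 <= 1 by rewrite expr_le1// ltW.
have L0 : 0 < L.
  by rewrite -(pmulr_rgt0 _ (exprn_gt0 2 g0)); apply: lt_le_trans hL4.
apply: le_trans hL4 _; rewrite -[X in _ <= X]mul1r ler_wpM2r//.
exact: ltW.
Qed.
Let L0 : 0 <= L. Proof. by apply: le_trans L32. Qed.
Let r0 : 2 <= r%:R :> R. Proof. by rewrite ler_nat. Qed.
Let D0 : 0 <= D. Proof. by rewrite divr_ge0 ?mulr_ge0. Qed.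
(** The factor [1 - eta] is lost twice, in linearising the hit probability and in replacing [n - r]
    by [n]; the factor [c] below is lost in the size of the union. In total
    [(1 - eta) ^+ 2 * c >= 1 - g / 4]. *)
Let eta : R := g / 16.
Let c : R := 1 - g / 8.
Let c01 : 0 <= c <= 1.
Proof. by have h0 := g0; have h1 := g1; apply/andP; rewrite /c; split; lra. Qed.
Let eta01 : 0 <= eta <= 1.
Proof. by have h0 := g0; have h1 := g1; apply/andP; rewrite /eta; split; lra. Qed.

Let nAD : n%:R * (A * D) <= 4 * L.
Proof.
have : n%:R * (A * D) <= n%:R * (2 * b) by rewrite ler_wpM2l// ltW.
by case/andP: Lb => *; lra.
Qed.

Let rE : r%:R * expR (g * L) <= n%:R.
Proof.
rewrite nE; have -> : expR L = expR ((1 - g) * L) * expR (g * L).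
  by rewrite -expRD; congr expR; ring.
by rewrite ler_wpM2r ?expR_ge0.
Qed.

Let rD : r%:R * D <= eta.
Proof.
have E0 := expR_gt0 (g * L); rewrite -(ler_pM2r E0) -(ler_pM2r A0).
have h1 : r%:R * expR (g * L) * (A * D) <= n%:R * (A * D).
  by rewrite ler_wpM2r// mulr_ge0// ltW.
have h2 : 4 * L / A * A <= g / 16 * expR (g * L) * A by rewrite ler_wpM2r// ltW.
rewrite divfK ?gt_eqF// in h2; have h3 := nAD; rewrite /eta; lra.
Qed.

Let rn : r%:R <= eta * n%:R.
Proof.
have h1 : 1 <= eta * expR (g * L).
  apply: le_trans hL1; rewrite ler_pdivlMr// mul1r.
  by have h := L32; have h' := A1; lra.
have h2 : r%:R * 1 <= r%:R * (eta * expR (g * L)) by rewrite ler_wpM2l.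
have h3 : eta * (r%:R * expR (g * L)) <= eta * n%:R by rewrite ler_wpM2l//; case/andP: eta01.
lra.
Qed.

Let x : R := r%:R * kap%:R / P%:R.
Let x0 : 0 <= x. Proof. by rewrite divr_ge0 ?mulr_ge0. Qed.

(* [kap ^ 2 <= kap * lam] is of order [P * L / n], so [x] is small even though
   [P] may exceed [n] by any amount. *)
Let x_small : x <= expR (- (g * L / 2)).
Proof.
have E0 := expR_gt0 (g * L).
rewrite -(@ler_pXn2r _ 2) ?nnegrE ?expR_ge0// -expRM_natr.
have -> : - (g * L / 2) * 2 = - (g * L) by field.
rewrite expRN -div1r ler_pdivlMr ?expR_gt0//.
have xD : x ^+ 2 <= r%:R ^+ 2 * D / P%:R.
  have -> : x ^+ 2 = r%:R ^+ 2 * (kap%:R * kap%:R) * (P%:R^-1 * P%:R^-1) by rewrite /x; ring.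
  have -> : r%:R ^+ 2 * D / P%:R = r%:R ^+ 2 * (kap%:R * lam%:R) * (P%:R^-1 * P%:R^-1).
    by rewrite /D; ring.
  rewrite ler_wpM2r ?mulr_ge0 ?invr_ge0// ler_wpM2l ?exprn_ge0// ler_wpM2l//.
  by rewrite ler_nat.
rewrite -(ler_pM2r E0).
apply: (@le_trans _ _ (r%:R ^+ 2 * D / P%:R * expR (g * L) * expR (g * L))).
  by rewrite ler_wpM2r ?(ltW E0)// ler_wpM2r ?(ltW E0).
have -> : r%:R ^+ 2 * D / P%:R * expR (g * L) * expR (g * L) =
   (r%:R * expR (g * L)) ^+ 2 * (D / P%:R) by ring.
apply: (@le_trans _ _ (n%:R ^+ 2 * (D / P%:R))).
  have rE0 : 0 <= r%:R * expR (g * L) by rewrite mulr_ge0// ltW.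
  by rewrite ler_wpM2r ?divr_ge0// lerXn2r ?nnegrE.
rewrite mul1r; apply: le_trans hL2.
rewrite mulrA ler_pdivrMr// [X in _ <= X]mulrAC ler_pdivlMr ?mulr_gt0//.
have -> : n%:R ^+ 2 * D * (A * c0) = n%:R * (A * D) * (c0 * n%:R) by ring.
by apply: ler_pM; rewrite ?nAD// mulr_ge0// ?(ltW n0)// ?(ltW c0_gt0)// mulr_ge0// ltW.
Qed.

Let t := Num.truncn (c * r%:R * kap%:R).
Let y0 : 0 <= c * r%:R * kap%:R.
Proof. by case/andP: c01 => h _; rewrite !mulr_ge0. Qed.
Let t_le : t%:R <= c * r%:R * kap%:R.
Proof. by rewrite truncn_le. Qed.
Let t_ge : c * r%:R * kap%:R <= t.+1%:R.
Proof. by rewrite ltW// truncnS_gt. Qed.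
Let t_le' : t%:R <= r%:R * kap%:R :> R.
Proof.
apply: le_trans t_le _; rewrite -mulrA -[X in _ <= X]mul1r ler_wpM2r ?mulr_ge0//.
by case/andP: c01.
Qed.
Let trk : (t <= r * kap)%N. Proof. by rewrite -(ler_nat R) natrM. Qed.
Let x1 : x <= 1.
Proof.
apply: le_trans x_small _; rewrite -[X in _ <= X]expR0 ler_expR oppr_le0.
by rewrite divr_ge0// mulr_ge0// ltW.
Qed.
Let tP : (t <= P)%N.
Proof.
rewrite -(ler_nat R); apply: le_trans t_le' _.
by have := x1; rewrite /x ler_pdivrMr// mul1r.
Qed.

Let q0 : R := (1 - eta) * (c * r%:R * b).
Let b0 : 0 <= b. Proof. by rewrite bE hit_prob_ge0. Qed.

Let q0_ge0 : 0 <= q0.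
Proof.
case/andP: eta01 => _ h; case/andP: c01 => h1 _.
by rewrite mulr_ge0 ?subr_ge0// !mulr_ge0.
Qed.

(** Both sides are compared with the linear sum over the groups: [b] from above at [kap] objects,
    [hit_prob] from below at [c * r * kap] objects, which [t.+1] exceeds. *)
Let q0_hit : q0 <= hit_prob P a K t.+1.
Proof.
case/andP: (eta01) => _ h; case/andP: (c01) => h1 h1'.
apply: le_trans (@hit_prob_ge_degree _ _ _ _ _ im a_ge0 K_range K_max P_gt0 t.+1
  (c * r%:R * kap%:R) eta _ eta01 _).
- rewrite ler_wpM2l ?subr_ge0// bE.
  have h2 := hit_prob_le_degree a_ge0 K_range (K_le i0).
  apply: le_trans (ler_wpM2l _ h2) _; first by rewrite mulr_ge0.
  rewrite mulr_sumr le_eqVlt; apply/orP; left; apply/eqP; apply: eq_bigr => i _; ring.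
- by rewrite y0 t_ge.
- apply: le_trans rD.
  have -> : c * r%:R * kap%:R * lam%:R / P%:R = c * (r%:R * D) by rewrite /D; ring.
  by rewrite -[X in _ <= X]mul1r ler_wpM2r// mulr_ge0.
Qed.

Let nr : (1 - eta) * n%:R <= (n - r)%:R.
Proof.
have rn' : (r <= n)%N.
  rewrite -(ler_nat R); apply: le_trans rn _; rewrite -[X in _ <= X]mul1r ler_wpM2r//.
  by case/andP: eta01.
by rewrite natrB//; have := rn; lra.
Qed.

Let nrq : (1 - g / 4) * (r%:R * L) <= (n - r)%:R * q0.
Proof.
case/andP: (eta01) => _ h; case/andP: (c01) => h1 h1'.
apply: (@le_trans _ _ ((1 - eta) * n%:R * q0)); last by rewrite ler_wpM2r.
have -> : (1 - eta) * n%:R * q0 = (1 - eta) ^+ 2 * c * (r%:R * (n%:R * b)) by rewrite /q0; ring.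
have rL : 0 <= r%:R * L by rewrite mulr_ge0.
have cc : 1 - g / 4 <= (1 - eta) ^+ 2 * c.
  have -> : (1 - eta) ^+ 2 * c = 1 - g / 4 + ((g / 8) ^+ 2 + (g / 16) ^+ 2 * c).
    by rewrite /eta /c; field.
  by rewrite lerDl addr_ge0 ?sqr_ge0// mulr_ge0 ?sqr_ge0.
apply: (@le_trans _ _ ((1 - eta) ^+ 2 * c * (r%:R * L))).
  by rewrite ler_wpM2r.
have c2 : 0 <= (1 - eta) ^+ 2 * c by rewrite mulr_ge0 ?sqr_ge0.
by rewrite ler_wpM2l// ler_wpM2l//; case/andP: Lb.
Qed.

Let rnq : r.-1%:R <= (n - r)%:R * q0.
Proof.
apply: le_trans nrq; apply: (@le_trans _ _ r%:R); first by rewrite ler_nat leq_pred.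
have h1 : 1 <= (1 - g / 4) * L.
  have h : 3 / 4 <= 1 - g / 4 by have := g1; lra.
  have := ler_wpM2r L0 h; have := L32; lra.
have : r%:R * 1 <= r%:R * ((1 - g / 4) * L) by rewrite ler_wpM2l.
lra.
Qed.

(** At least [g / 8 * r * kap] objects are repetitions, each costing [expR (- (g * L / 2))]. Half of
    the resulting exponent outweighs [t] by [hL4], the other half outweighs [2 * r * L] by
    [hkap]. *)
Let first_term : n%:R ^+ r * (expR t%:R * (t%:R / P%:R) ^+ (r * kap - t)) <= expR (- L) ^+ r.
Proof.
have rk0 : 0 <= r%:R * kap%:R :> R by rewrite mulr_ge0.
have hx : t%:R / P%:R <= expR (- (g * L / 2)).
  by apply: le_trans x_small; rewrite ler_wpM2r ?invr_ge0.
apply: (@le_trans _ _ (n%:R ^+ r * (expR t%:R * expR (- (g * L / 2)) ^+ (r * kap - t)))).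
  rewrite ler_wpM2l ?exprn_ge0// ler_wpM2l ?expR_ge0//.
  by rewrite lerXn2r ?nnegrE ?expR_ge0// divr_ge0.
rewrite nE -!expRM_natr -!expRD ler_expR natrB// natrM.
have h1 : g / 8 * (r%:R * kap%:R) <= r%:R * kap%:R - t%:R.
  by have := t_le; rewrite /c; lra.
have h2 : g * L / 2 * (g / 8 * (r%:R * kap%:R)) <= g * L / 2 * (r%:R * kap%:R - t%:R).
  by rewrite ler_wpM2l// divr_ge0// mulr_ge0// ltW.
have h3 : 32 * (r%:R * kap%:R) <= g ^+ 2 * L * (r%:R * kap%:R) by rewrite ler_wpM2r.
have h4 : 64 * (r%:R * L) <= g ^+ 2 * kap%:R * (r%:R * L).
  by rewrite ler_wpM2r// mulr_ge0.
have h5 := t_le'.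
have -> : - (g * L / 2) * (r%:R * kap%:R - t%:R) = - (g * L / 2 * (r%:R * kap%:R - t%:R)) by ring.
set X := g * L / 2 * (_ - _) in h2 *.
have e5 : g * L / 2 * (g / 8 * (r%:R * kap%:R)) = g ^+ 2 * L * (r%:R * kap%:R) / 16 by field.
have e6 : g ^+ 2 * kap%:R * (r%:R * L) = g ^+ 2 * L * (r%:R * kap%:R) by ring.
rewrite e5 in h2; rewrite e6 in h4; lra.
Qed.

(** All but one of the [r] factors [n] are paired with a [q0], and [n * q0] is below [n^(1-g+g/16)].
    The non-edges then cancel the unpaired [n] up to [g / 4 * L], which is absorbed because
    [r.-1 >= 1]. *)
Let second_term : n%:R ^+ r * (q0 ^+ r.-1 * expR (- ((n - r)%:R * q0))) <=
  expR (- (g / 4 * L)) ^+ r.-1.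
Proof.
case/andP: (eta01) => e0 e1; case/andP: (c01) => h1 h1'.
have rS : n%:R ^+ r = n%:R * n%:R ^+ r.-1 :> R by rewrite -exprS prednK// ltnW.
have nq0 : 0 <= n%:R * q0 by rewrite mulr_ge0// ltW.
have nq : n%:R * q0 <= expR ((1 - g) * L + g / 16 * L).
  apply: (@le_trans _ _ (r%:R * (2 * L))).
    have -> : n%:R * q0 = (1 - eta) * c * (r%:R * (n%:R * b)) by rewrite /q0; ring.
    apply: (@le_trans _ _ (r%:R * (n%:R * b))).
      rewrite -[X in _ <= X]mul1r ler_wpM2r ?mulr_ge0// ?(ltW n0)//.
      by rewrite mulr_ile1// ?subr_ge0// lerBlDr lerDl.
    by rewrite ler_wpM2l//; case/andP: Lb.
  by rewrite expRD; apply: ler_pM => //; rewrite mulr_ge0.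
rewrite rS mulrA -[n%:R * _ * _]mulrA -exprMn.
apply: (@le_trans _ _ (expR L * expR ((1 - g) * L + g / 16 * L) ^+ r.-1 *
   expR (- ((1 - g / 4) * (r%:R * L))))).
  apply: ler_pM; rewrite ?expR_ge0// ?mulr_ge0// ?exprn_ge0// ?(ltW n0)//; last first.
    by rewrite ler_expR lerN2.
  by rewrite -nE ler_wpM2l ?(ltW n0)// lerXn2r ?nnegrE ?expR_ge0.
have rr : r%:R = r.-1%:R + 1 :> R by rewrite natr1 prednK// ltnW.
have r1 : 1 <= r.-1%:R :> R by have := r0; lra.
rewrite -!expRM_natr -!expRD ler_expR rr; set q := r.-1%:R in r1 *.
have gL : 0 <= g * L by rewrite mulr_ge0// ltW.
have := ler_wpM2l gL r1; lra.
Qed.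

Lemma small_term_le (s : seq 'I_n) : uniq s -> size s = r ->
  n%:R ^+ r * expect (fun=> vertex_law a K) (fun w : outcome m n P => (component w s)%:R) <=
  expR (- L) ^+ r + expR (- (g / 4 * L)) ^+ r.-1.
Proof.
move=> us sr; apply: le_trans (lerD first_term second_term); rewrite -mulrDr ler_wpM2l ?exprn_ge0//.
rewrite -sr; apply: (@small_component_prob R m n P a K i0) => //; rewrite ?sr//.
- exact: ltnW.
- by rewrite q0_ge0 q0_hit.
Qed.

End SmallTerms.

(** * The two bounds for fixed n *)

Section OneLaw.
Variables (R : realType) (m n P : nat) (a : 'I_m -> R) (K : 'I_m -> nat) (i0 im : 'I_m).
Variables (c0 : R).
Local Notation kap := (K i0).
Local Notation lam := (K im).
Local Notation A := (a im).
Local Notation L := (ln n%:R : R).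
Let g : R := A / 64.
Let b : R := hit_prob P a K kap.
Let D : R := kap%:R * lam%:R / P%:R.
Hypothesis a_ge0 : forall i, 0 <= a i.
Hypothesis a_sum1 : \sum_i a i = 1.
Hypothesis K_range : forall i, (0 < K i <= P)%N.
Hypothesis K_min : forall i, (K i0 <= K i)%N.
Hypothesis K_max : forall i, (K i <= K im)%N.
Hypothesis n_gt0 : (0 < n)%N.
Hypothesis P_gt0 : (0 < P)%N.
Hypothesis c0_gt0 : 0 < c0.
Hypothesis nP : c0 * n%:R <= P%:R.
Hypothesis A_gt0 : 0 < A.
Hypothesis Lb : L <= n%:R * b <= 2 * L.
Hypothesis D1 : kap%:R * lam%:R <= P%:R :> R.
Hypothesis hL1 : 4 * L / A <= g / 16 * expR (g * L).
Hypothesis hL2 : 4 * L / (A * c0) <= expR (g * L).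
Hypothesis hL3 : 2 * L <= expR (g / 16 * L).
Hypothesis hL4 : 32 <= g ^+ 2 * L.
Hypothesis hkap : 64 <= g ^+ 2 * kap%:R.

(** Ratios of geometric series over component sizes: [y1] to [y4] for sizes above [r0], [y5] and
    [y6] for sizes up to [r0]. A ratio of at most [1 / 2] bounds its series by twice the ratio. *)
Let y1 : R := 64 / c0 * (kap%:R * 2^-1 ^+ kap).
Let y2 : R := 4 * expR (- (A / 64 * L)).
Let y3 : R := expR (1 - A * kap%:R / 16 / 16).
Let y4 : R := expR (1 - A * L / 64).
Let y5 : R := expR (- L).
Let y6 : R := expR (- (g / 4 * L)).
Hypotheses (y1s : y1 <= 2^-1) (y2s : y2 <= 2^-1) (y3s : y3 <= 2^-1)
  (y4s : y4 <= 2^-1) (y5s : y5 <= 2^-1) (y6s : y6 <= 2^-1).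

Let nE : n%:R = expR L :> R. Proof. by rewrite lnK// posrE ltr0n. Qed.
Let A1 : A <= 1.
Proof. by rewrite -a_sum1 (bigD1 im)//= lerDl sumr_ge0. Qed.
Let g0 : 0 < g. Proof. by rewrite divr_gt0. Qed.
Let g1 : g <= A. Proof. by have := A_gt0; rewrite /g; lra. Qed.
Let g1' : g <= 1. Proof. by apply: le_trans g1 A1. Qed.
Let K_le i : (K i <= P)%N. Proof. by case/andP: (K_range i). Qed.
Let gg : g ^+ 2 <= A / 64.
Proof. by rewrite expr2 -[X in _ <= X]mulr1 ler_wpM2l// ltW. Qed.
Let L0 : 0 <= L.
Proof. by rewrite ln_ge0// ler1n. Qed.
Let AL : 64 <= A * L.
Proof. by have h := ler_wpM2r L0 gg; have := hL4; lra. Qed.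
Let Akap : 256 <= A * kap%:R.
Proof. by have h := ler_wpM2r (ler0n R kap) gg; have := hkap; lra. Qed.
Let AD : A * D <= 2 * b.
Proof. exact: hit_prob_ge_max. Qed.
Let bD : b <= D.
Proof.
apply: le_trans (hit_prob_le_degree a_ge0 K_range (K_le i0)) _.
exact: degree_le.
Qed.
Let n0 : 0 < n%:R :> R. Proof. by rewrite ltr0n. Qed.
Let Ln : L <= n%:R.
Proof. by have := expR_ge1Dx L; rewrite -nE => *; lra. Qed.
Let b1 : b <= 1.
Proof.
rewrite -a_sum1 /b /hit_prob; apply: ler_sum => i _.
by rewrite ler_piMr// lerBlDr lerDl rho_ge0.
Qed.

Let r0 := Num.truncn (expR ((1 - g) * L)).
(** With high probability the last group has at least [n * A / 4] members, which is at least
    [2 * k]. *)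
Let k := Num.truncn (n%:R * A / 8).
Let T0 := (P %/ 16)%N.
Let f (r : nat) : R := y1 ^+ r + y2 ^+ r + y4 ^+ r + 3 * y3 ^+ r.

Let y1_ge0 : 0 <= y1.
Proof. by rewrite mulr_ge0 ?divr_ge0 ?(ltW c0_gt0)// mulr_ge0 ?exprn_ge0 ?invr_ge0. Qed.
Let y2_ge0 : 0 <= y2. Proof. by rewrite mulr_ge0 ?expR_ge0. Qed.
Let y3_ge0 : 0 <= y3. Proof. exact: expR_ge0. Qed.
Let y4_ge0 : 0 <= y4. Proof. exact: expR_ge0. Qed.
Let y5_ge0 : 0 <= y5. Proof. exact: expR_ge0. Qed.
Let y6_ge0 : 0 <= y6. Proof. exact: expR_ge0. Qed.
Let f_ge0 r : 0 <= f r.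
Proof. by rewrite !addr_ge0 ?mulr_ge0 ?exprn_ge0. Qed.

Let nA0 : 0 <= n%:R * A / 8.
Proof. by rewrite divr_ge0 ?mulr_ge0// ltW. Qed.
Let k_le : k%:R <= n%:R * A / 8.
Proof. by rewrite truncn_le. Qed.
Let k_ge : n%:R * A / 16 <= k%:R.
Proof.
have h1 : n%:R * A / 8 < k%:R + 1 by rewrite natr1 truncnS_gt.
have h2 : A * L <= A * n%:R by rewrite ler_wpM2l// ltW.
by have h3 := AL; lra.
Qed.

Let large_part :
  Prob a K (fun w : outcome m n P => [exists S : {set 'I_n},
     [&& (r0 < #|S|)%N, (#|S| <= n./2)%N & closed_off snd w (enum S)]]) <=
  expR (- (A / 4 * L)) + 2 * (y1 + y2 + y4 + 3 * y3).
Proof.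
apply: le_trans (@large_components_le R m n P a K i0 im a_ge0 a_sum1 K_le K_min P_gt0
  k T0 _ r0 (n%:R * A / 4) f _ _ f_ge0) _.
- exact: leq_div.
- move=> N yN; rewrite -(ler_nat R) natrM; apply: le_trans yN.
  by have := k_le; lra.
- move=> r rr rn; apply: (@large_term_le R n P kap lam k r A L c0) => //.
  + by rewrite A_gt0 A1.
  + by rewrite (leq_trans _ rr).
  + by rewrite mul2n -(odd_double_half n) (leq_trans _ (leq_addl _ _))// leq_double.
  + apply: le_trans (ler_wpM2l (ltW n0) bD); by case/andP: Lb.
  + apply: le_trans (ltW (truncnS_gt _)) _; by rewrite ler_nat.
apply: lerD.
  rewrite ler_expR; have := ler_wpM2l (ltW A_gt0) Ln; lra.
rewrite big_mkcond big_ord_recl /= add0r.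
have -> : 2 * (y1 + y2 + y4 + 3 * y3) = 2 * y1 + 2 * y2 + 2 * y4 + 3 * (2 * y3) by ring.
rewrite /f !big_split /= -mulr_sumr.
by rewrite !lerD ?ler_wpM2l// geometric_le ?y1_ge0 ?y2_ge0 ?y3_ge0 ?y4_ge0.
Qed.

Let tuple_sum r (B : R) :
  (forall s : r.-tuple 'I_n, uniq s ->
    n%:R ^+ r * expect (fun=> vertex_law a K) (fun w : outcome m n P => (component w s)%:R) <= B) ->
  0 <= B ->
  \sum_(s : r.-tuple 'I_n | uniq s)
    expect (fun=> vertex_law a K) (fun w : outcome m n P => (component w s)%:R) <= B.
Proof.
move=> sB B0; have nr : 0 < n%:R ^+ r :> R by rewrite exprn_gt0.
apply: (@le_trans _ _ (\sum_(s : r.-tuple 'I_n) B / n%:R ^+ r)).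
  rewrite big_mkcond; apply: ler_sum => s _; case: ifP => us.
    by rewrite ler_pdivlMr// mulrC sB.
  by rewrite divr_ge0// ltW.
rewrite sumr_const card_tuple card_ord -[X in X <= _]mulr_natr natrX divfK//.
by rewrite gt_eqF.
Qed.

Let small_part :
  \sum_(r < r0) \sum_(s : r.+1.-tuple 'I_n | uniq s)
    expect (fun=> vertex_law a K) (fun w : outcome m n P => (component w s)%:R) <=
  expR (1 - (n%:R * b - L)) + 2 * y5 + 2 * y6.
Proof.
have e0 := expR_ge0 (1 - (n%:R * b - L)).
case r0E : r0 => [|r1].
  rewrite big_ord0; have := y5_ge0; have := y6_ge0; lra.
rewrite big_ord_recl /= -addrA lerD//.
  (* Isolated vertices: [n * expR (- ((n - 1) * b))], where [b <= 1] accounts for the 1 in the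
     exponent. *)
  apply: tuple_sum => // s us.
  have [v ->] : exists v, tval s = [:: v] by case: s us => [[|v [|]]] //= ? _; exists v.
  have h := @isolated_prob R m n P a K i0 a_ge0 a_sum1 K_le K_min v.
  rewrite expr1; apply: le_trans (ler_wpM2l (ltW n0) h) _.
  rewrite nE -expRD ler_expR natrB// -nE -/b; have := b1; lra.
apply: (@le_trans _ _ (\sum_(i < r1) (y5 ^+ i.+1 + y6 ^+ i.+1))); last first.
  by rewrite big_split /= lerD ?geometric_le ?y5_ge0 ?y6_ge0.
apply: ler_sum => i _; apply: (@le_trans _ _ (y5 ^+ i.+2 + y6 ^+ i.+1)); last first.
  rewrite lerD2r exprS ler_piMl ?exprn_ge0//; have := y5s; lra.
apply: tuple_sum => [s us|]; last by rewrite addr_ge0 ?exprn_ge0.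
apply: (@small_term_le R m n P a K i0 im A L b c0 g i.+2) => //.
- by rewrite A_gt0 A1.
- by rewrite g0 g1'.
- have h : i.+2%:R <= r0%:R :> R by rewrite ler_nat r0E ltnS ltn_ord.
  by apply: le_trans h _; rewrite truncn_le expR_ge0.
- by rewrite size_tuple.
Qed.

Lemma one_law_bound :
  1 - prob_connected n P a K <=
  expR (1 - (n%:R * b - L)) + 2 * y5 + 2 * y6 +
  (expR (- (A / 4 * L)) + 2 * (y1 + y2 + y4 + 3 * y3)).
Proof.
apply: le_trans (@disconnected_le R m n P a K a_ge0 a_sum1 K_le r0) _.
by apply: lerD; [exact: small_part | exact: large_part].
Qed.

End OneLaw.

(** * Upper bound on the connectivity probability *)

Section ZeroLaw.
Variables (R : realType) (m n P : nat) (a : 'I_m -> R) (K : 'I_m -> nat) (i0 : 'I_m).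
Local Notation L := (ln n%:R : R).
Let b : R := hit_prob P a K (K i0).
Let C : R := \sum_i (a i)^-1.
(** A common error scale: [b <= 2 * z] and [n * b ^+ 2 <= 4 * z]. *)
Let z : R := L ^+ 2 / n%:R.
Hypothesis a_gt0 : forall i, 0 < a i.
Hypothesis a_sum1 : \sum_i a i = 1.
Hypothesis K_le : forall i, (K i <= P)%N.
Hypothesis n_gt1 : (1 < n)%N.
Hypothesis nb : n%:R * b <= 2 * L.
Hypothesis L1 : 1 <= L.
Hypothesis z4 : z <= 4^-1.

Let a_ge0 i : 0 <= a i. Proof. exact: ltW. Qed.
Let n0 : 0 < n%:R :> R. Proof. by rewrite ltr0n ltnW. Qed.
Let b0 : 0 <= b. Proof. exact: hit_prob_ge0. Qed.
Let C0 : 0 <= C. Proof. by apply: sumr_ge0 => i _; rewrite invr_ge0. Qed.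
Let z0 : 0 <= z. Proof. by rewrite divr_ge0 ?sqr_ge0. Qed.
Let nz : n%:R * z = L ^+ 2. Proof. by rewrite /z mulrC divfK// gt_eqF. Qed.
Let L0 : 0 <= L. Proof. exact: le_trans L1. Qed.

Let bz : b <= 2 * z.
Proof.
rewrite -(ler_pM2l n0) mulrCA nz; apply: le_trans nb _.
by rewrite ler_wpM2l// expr2 -[X in X <= _]mulr1 ler_wpM2l.
Qed.

Let nb2 : n%:R * b ^+ 2 <= 4 * z.
Proof.
rewrite -(ler_pM2l n0) mulrA -expr2 -exprMn mulrCA nz.
have -> : 4 * L ^+ 2 = (2 * L) ^+ 2 by ring.
by rewrite lerXn2r ?nnegrE ?mulr_ge0// ltW.
Qed.

Let b2 : b <= 2^-1.
Proof. by have h1 := bz; have h2 := z4; lra. Qed.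

(* The correction [C * b ^+ 2] bounds the second moment over the groups of the
   hit probabilities [p], through [a i * p i <= b]. *)
Let hit_double v :
  miss_prob P (fun _ : 'I_n => a) K v (2 * K i0) <= 1 - 2 * b + C * b ^+ 2.
Proof.
pose p i := 1 - rho R P (K i) (K i0).
have p0 i : 0 <= p i by rewrite subr_ge0 rho_le1.
apply: (@le_trans _ _ (\sum_i (a i - 2 * (a i * p i) + (a i)^-1 * b ^+ 2))).
  apply: ler_sum => i _; apply: (@le_trans _ _ (a i * (1 - p i) ^+ 2)).
    by rewrite ler_wpM2l// /p subKr; exact: rho_double.
  have -> : a i * (1 - p i) ^+ 2 = a i - 2 * (a i * p i) + (a i)^-1 * (a i * p i) ^+ 2.
    by field; rewrite gt_eqF.
  rewrite lerD2l ler_wpM2l ?invr_ge0// lerXn2r ?nnegrE ?mulr_ge0//.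
  rewrite /b /hit_prob (bigD1 i)//= lerDl sumr_ge0// => j _.
  by rewrite mulr_ge0// subr_ge0 rho_le1.
rewrite big_split /= -mulr_suml lerD2r sumrB -mulr_sumr a_sum1.
exact: lexx.
Qed.

Let inv_le (d : R) : 0 < d -> d * (1 - b) ^- 2 <= d * expR (4 * b).
Proof.
move=> d0; rewrite ler_pM2l//.
have hb := b2; have h0 := b0.
have h1 : (1 - b)^-1 <= expR (2 * b).
  apply: le_trans (expR_ge1Dx _); rewrite -div1r ler_pdivrMr; last by lra.
  nra.
have -> : expR (4 * b) = expR (2 * b) ^+ 2 by rewrite -expRM_natr; congr expR; ring.
rewrite -exprVn lerXn2r ?nnegrE ?expR_ge0// invr_ge0; lra.
Qed.

(** For [b <= 1 / 2], [1 - b >= expR (- (b + 2 * b ^+ 2))]; the quadratic terms add up to at most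
    [8 * z]. *)
Let pow_ge : expR (- (n%:R * b + 8 * z)) <= (1 - b) ^+ n.-1.
Proof.
have hb := b2; have h0 := b0.
have b1 : 0 < 1 - b by lra.
have h1 : expR (- (b + 2 * b ^+ 2)) <= 1 - b.
  rewrite expRN -[X in _ <= X]invrK lef_pV2 ?posrE ?invr_gt0 ?expR_gt0//.
  apply: le_trans (expR_ge1Dx _); rewrite -div1r ler_pdivrMr//.
  have : 0 <= b ^+ 2 * (1 - 2 * b) by rewrite mulr_ge0 ?sqr_ge0//; lra.
  lra.
apply: (@le_trans _ _ ((1 - b) ^+ n)); last by rewrite ler_wiXn2l ?leq_pred//; lra.
apply: (@le_trans _ _ (expR (- (b + 2 * b ^+ 2)) ^+ n)); last first.
  by rewrite lerXn2r ?nnegrE ?expR_ge0 ?(ltW b1).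
rewrite -expRM_natr ler_expR; have := nb2; lra.
Qed.

Lemma zero_law_bound :
  prob_connected n P a K <=
  expR (n%:R * b - L + 8 * z) / a i0 + (expR ((16 * C + 8) * z) - 1).
Proof.
pose mu : R := n%:R * (a i0 * (1 - b) ^+ n.-1).
have hb := b2; have h0 := b0; have b1 : 0 < 1 - b by lra.
have mu0 : 0 < mu by rewrite !mulr_gt0// exprn_gt0.
pose v : 'I_n := Ordinal n_gt1.
apply: le_trans (@connected_second_moment R m n P a K i0 a_ge0 a_sum1 K_le n_gt1 mu0 v) _.
rewrite -/mu; set M := miss_prob _ _ _ _ _.
have M0 : 0 <= M by exact: miss_prob_ge0.
(* The variance ratio splits into [1 / mu] and the excess of the pair probability over
   independence. *)
have -> : (mu + n%:R ^+ 2 * (a i0 ^+ 2 * M ^+ (n - 2)) - mu ^+ 2) / mu ^+ 2 =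
    mu^-1 + (M ^+ (n - 2) / ((1 - b) ^+ n.-1) ^+ 2 - 1).
  rewrite /mu; field.
  by rewrite !gt_eqF//= exprn_gt0.
apply: lerD.
  rewrite -[X in _ <= X]invrK lef_pV2 ?posrE ?invr_gt0 ?divr_gt0 ?expR_gt0//.
  rewrite invf_div -expRN /mu.
  have -> : expR (- (n%:R * b - L + 8 * z)) = expR L * expR (- (n%:R * b + 8 * z)).
    by rewrite -expRD; congr expR; ring.
  by rewrite lnK ?posrE// mulrCA !ler_pM2l.
rewrite lerD2r.
have hM : M <= (1 - b) ^+ 2 * expR (4 * C * b ^+ 2).
  apply: le_trans (hit_double v) _.
  apply: (@le_trans _ _ ((1 - b) ^+ 2 * (1 + 4 * C * b ^+ 2))); last first.
    by rewrite ler_wpM2l ?sqr_ge0// expR_ge1Dx.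
  have h4 : 1 <= 4 * (1 - b) ^+ 2 by nra.
  have h5 : 0 <= C * b ^+ 2 by rewrite mulr_ge0 ?sqr_ge0.
  have h6 := ler_wpM2l h5 h4; have h7 := sqr_ge0 b; lra.
apply: (@le_trans _ _ (((1 - b) ^+ 2 * expR (4 * C * b ^+ 2)) ^+ (n - 2) / (1 - b) ^+ n.-1 ^+ 2)).
  rewrite ler_wpM2r ?invr_ge0 ?sqr_ge0// lerXn2r ?nnegrE//.
  by rewrite mulr_ge0 ?sqr_ge0 ?expR_ge0.
(* The pair bound has [n - 2] outside vertices against [n - 1] for each single one; the leftover
   [(1 - b) ^- 2] goes to [inv_le]. *)
have e1 : n.-1 = (n - 2).+1 by case: (n) n_gt1 => [|[|k]] // _; rewrite subSS subSS subn0.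
set E := expR (4 * C * b ^+ 2) ^+ (n - 2).
have E0 : 0 < E by rewrite exprn_gt0 ?expR_gt0.
have w0 : 0 < (1 - b) ^+ (n - 2) by rewrite exprn_gt0.
rewrite exprMn [_ ^+ 2 ^+ (n - 2)]exprAC e1 [(1 - b) ^+ (n - 2).+1]exprS -/E.
have cancel (w e d : R) : 0 < w -> 0 < d -> w ^+ 2 * e / (d * w) ^+ 2 = e * d ^- 2.
  by move=> w_gt0 d_gt0; field; rewrite !gt_eqF.
rewrite (cancel _ _ _ w0 b1).
apply: le_trans (inv_le E0) _.
rewrite /E -expRM_natr -expRD ler_expR.
have h1 : (n - 2)%:R <= n%:R :> R by rewrite ler_nat leq_subr.
have h2 : 4 * C * b ^+ 2 * (n - 2)%:R <= 4 * C * b ^+ 2 * n%:R.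
  by rewrite ler_wpM2l// mulr_ge0 ?sqr_ge0// mulr_ge0.
have h3 : 4 * C * (n%:R * b ^+ 2) <= 4 * C * (4 * z) by rewrite ler_wpM2l// mulr_ge0.
have h4 := bz; lra.
Qed.

End ZeroLaw.

(** * Limits *)

Local Open Scope classical_set_scope.

Section Limits.
Variables (R : realType) (u : nat -> R).
Hypothesis u_oo : u n @[n --> \oo] --> (+oo : set_system R).

(** The quadratic term of the exponential series exceeds [C * u n] once [u n >= 2 * C / g ^+ 2]. *)
Lemma near_linear_le_expR (C g : R) : 0 < g ->
  \forall n \near \oo, C * u n <= expR (g * u n).
Proof.
move=> g0; have /cvgryPge h := u_oo; near=> n.
have u0 : 0 <= u n by near: n; exact: h.
have uC : 2 * C / g ^+ 2 <= u n by near: n; exact: h.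
have gu0 : 0 <= g * u n by rewrite mulr_ge0// ltW.
apply: le_trans (expR_ge1Dxn 1 gu0).
rewrite ler_pdivrMr ?exprn_gt0// in uC.
have := ler_wpM2l u0 uC.
rewrite (_ : 2`!%:R = 2 :> R)//; lra.
Unshelve. all: by end_near. Qed.

Lemma near_expR_le (d c e : R) : 0 < c -> 0 < e ->
  \forall n \near \oo, expR (d - c * u n) <= e.
Proof.
move=> c0 e0; have /cvgryPge h := u_oo; near=> n.
have : (d - ln e) / c <= u n by near: n; exact: h.
rewrite ler_pdivrMr// => uC.
rewrite -[X in _ <= X](@lnK _ e) ?posrE// ler_expR; lra.
Unshelve. all: by end_near. Qed.

End Limits.

Lemma cvg_ln_nat (R : realType) : ln (n%:R : R) @[n --> \oo] --> (+oo : set_system R).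
Proof.
apply/cvgryPge => A; near=> n.
have h : expR A <= n%:R by near: n; exact: nbhs_infty_ger.
by rewrite -[X in X <= _](expRK A) ler_ln ?posrE ?expR_gt0// (lt_le_trans _ h) ?expR_gt0.
Unshelve. all: by end_near. Qed.

Lemma prob_connected_ge0_le1 (R : realType) (m n P : nat) (a : 'I_m -> R) (K : 'I_m -> nat) :
  (forall i, 0 <= a i) -> \sum_i a i = 1 -> (forall i, (K i <= P)%N) ->
  0 <= prob_connected n P a K <= 1.
Proof.
move=> a0 a1 KP; rewrite /prob_connected Prob_expect.
have nu0 := @law_ge0 R _ m P (fun _ : 'I_n => a) K (fun=> a0).
have nu1 := @law_sum1 R _ m P (fun _ : 'I_n => a) K (fun=> a1) KP.
apply/andP; split; first exact: expect_ge0.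
rewrite -[X in _ <= X](expect_cst nu1); apply: le_expect => // w _.
by rewrite lern1 leq_b1.
Qed.

(* There are [m.+1 >= 1] groups: [ord0] is the first one, [ord_max] the last. *)
Theorem theorem1 (R : realType) (m : nat) (a : 'I_m.+1 -> R)
    (P : nat -> nat) (K : nat -> 'I_m.+1 -> nat) (beta : nat -> R)
    (a_gt0 : forall i, 0 < a i)
    (a_sum1 : \sum_i a i = 1)
    (K_range : forall n, (0 < n)%N -> forall i, (1 <= K n i <= P n)%N)
    (P_Omega : (fun n => (P n)%:R : R) \is 'Omega_\oo (fun n => n%:R : R))
    (K_first : (K n ord0)%:R @[n --> \oo] --> (+oo : set_system R))
    (K_mono : forall n, (0 < n)%N ->
       forall i j : 'I_m.+1, (i <= j)%N -> (K n i <= K n j)%N)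
    (K_last : (fun n => (K n ord_max)%:R : R) =o_\oo
              (fun n => Num.sqrt (P n)%:R : R))
    (beta_small : (fun n => `|beta n|) =o_\oo (fun n => ln n%:R : R))
    (b_eq : forall n, (0 < n)%N ->
       edge_prob a (K n) (P n) ord0 = (ln n%:R + beta n) / n%:R) :
  (beta n @[n --> \oo] --> -oo ->
     prob_connected n (P n) a (K n) @[n --> \oo] --> (0 : R)) /\
  (beta n @[n --> \oo] --> +oo ->
     prob_connected n (P n) a (K n) @[n --> \oo] --> (1 : R)).
Proof.
have a_ge0 i : 0 <= a i by apply: ltW.
have K_le n : (0 < n)%N -> forall i, (K n i <= P n)%N.
  by move=> n0 i; case/andP: (K_range n n0 i).
have Loo := @cvg_ln_nat R; have /cvgryPge Lge := Loo.
have /cvgryPge Kge := K_first.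
have beta_le : \forall n \near \oo, `|beta n| <= ln (n%:R : R).
  have /eqoP/(_ 1 ltr01) h := beta_small.
  near=> n; have : `| `|beta n| | <= 1 * `|ln (n%:R : R)| by near: n; exact: h.
  have L0 : 0 <= ln (n%:R : R) by near: n; exact: Lge.
  by rewrite normr_id mul1r (ger0_norm L0).
have nbE n : (0 < n)%N ->
    n%:R * hit_prob (P n) a (K n) (K n ord0) = ln n%:R + beta n.
  move=> n0; rewrite (_ : hit_prob _ _ _ _ = edge_prob a (K n) (P n) ord0)// b_eq//.
  by rewrite mulrC divfK// pnatr_eq0 -lt0n.
split=> beta_lim.
- apply/cvgr0Pnorm_le => e e0.
  pose C : R := \sum_i (a i)^-1.
  have C0 : 0 <= C by apply: sumr_ge0 => i _; rewrite invr_ge0.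
  (* The bound [1 / 8] makes [8 * z <= 1] and the condition [z <= 1 / 4] hold; the second entry
     makes the correlation term at most [e / 2]. *)
  pose d : R := Num.min 8^-1 (ln (1 + e / 2) / (16 * C + 8)).
  have C8 : 0 < 16 * C + 8 by lra.
  have d0 : 0 < d by rewrite lt_min invr_gt0 divr_gt0 ?ln_gt0//; lra.
  have nb_oo : - beta n @[n --> \oo] --> (+oo : set_system R) by exact/cvgNry.
  near=> n.
  have n1 : (1 < n)%N by near: n; exact: nbhs_infty_gt.
  have n0 : (0 < n)%N := ltnW n1.
  have /andP[p0 p1] := @prob_connected_ge0_le1 R m.+1 n (P n) a (K n) a_ge0 a_sum1 (K_le n n0).
  rewrite ger0_norm//.
  have L1 : 1 <= ln (n%:R : R) by near: n; exact: Lge.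
  have bL : `|beta n| <= ln (n%:R : R) by near: n.
  have h1 : 1 * ln (n%:R : R) <= expR (4^-1 * ln n%:R).
    by near: n; exact: near_linear_le_expR.
  have h2 : expR (0 - 2^-1 * ln (n%:R : R)) <= d.
    by near: n; apply: near_expR_le.
  pose z : R := ln n%:R ^+ 2 / n%:R.
  have zd : z <= d.
    apply: le_trans h2; rewrite /z ler_pdivrMr ?ltr0n//.
    rewrite -[X in _ * X](@lnK _ n%:R) ?posrE ?ltr0n// -expRD.
    apply: (@le_trans _ _ (expR (4^-1 * ln n%:R) ^+ 2)).
      by rewrite lerXn2r ?nnegrE ?expR_ge0; lra.
    by rewrite -expRM_natr ler_expR; lra.
  have z8 : z <= 8^-1 by apply: le_trans zd _; rewrite ge_min lexx.
  have zC : (16 * C + 8) * z <= ln (1 + e / 2).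
    by rewrite mulrC -ler_pdivlMr//; apply: le_trans zd _; rewrite ge_min lexx orbT.
  apply: le_trans (@zero_law_bound R m.+1 n (P n) a (K n) ord0 a_gt0 a_sum1 (K_le n n0) n1 _ L1 _) _.
  + rewrite nbE//; have := ler_norm (beta n); lra.
  + by rewrite -/z; lra.
  have h3 : expR (1 - 1 * - beta n) <= a ord0 * (e / 2).
    by near: n; apply: near_expR_le => //; rewrite mulr_gt0// divr_gt0.
  have h4 : expR (n%:R * hit_prob (P n) a (K n) (K n ord0) - ln n%:R + 8 * z) / a ord0 <= e / 2.
    rewrite ler_pdivrMr// [X in _ <= X]mulrC; apply: le_trans h3; rewrite nbE// ler_expR; lra.
  have h5 : expR ((16 * C + 8) * z) <= 1 + e / 2.
    by rewrite -[X in _ <= X]lnK ?posrE ?ler_expR//; lra.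
  rewrite -/z -/C; lra.
- apply/cvgrPdist_le => e e0.
  have [c0 c0_gt0 PO] : exists2 c0 : R, 0 < c0 & \forall n \near \oo, c0 * n%:R <= (P n)%:R :> R.
    move: P_Omega; rewrite qualifE => /asboolP[c0 c00 h]; exists c0 => //.
    near=> n; have : c0 * `|n%:R : R| <= `|(P n)%:R : R| by near: n; exact: h.
    by rewrite !ger0_norm.
  have KP : \forall n \near \oo, (K n ord_max)%:R ^+ 2 <= (P n)%:R :> R.
    have /eqoP/(_ 1 ltr01) h := K_last; near=> n.
    have : `|(K n ord_max)%:R : R| <= 1 * `|Num.sqrt (P n)%:R : R| by near: n; exact: h.
    rewrite mul1r !ger0_norm ?sqrtr_ge0// => h1.
    by rewrite -[X in _ <= X](@sqr_sqrtr _ (P n)%:R)// lerXn2r ?nnegrE ?sqrtr_ge0.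
  pose A := a ord_max; pose g := A / 64.
  have A0 : 0 < A := a_gt0 _.
  have g0 : 0 < g by rewrite divr_gt0.
  have g2 : 0 < g ^+ 2 by rewrite exprn_gt0.
  (* In [one_law_bound] the small quantities have total weight
     [1 + 2 + 2 + 1 + 2 * (1 + 1 + 1 + 3) = 18]. *)
  pose d := Num.min 2^-1 (e / 18).
  have d0 : 0 < d by rewrite lt_min; apply/andP; split; lra.
  near=> n.
  have n0 : (0 < n)%N by near: n; exact: nbhs_infty_gt.
  have /andP[p0 p1] := @prob_connected_ge0_le1 R m.+1 n (P n) a (K n) a_ge0 a_sum1 (K_le n n0).
  rewrite ger0_norm ?subr_ge0//.
  have L1 : 1 <= ln (n%:R : R) by near: n; exact: Lge.
  have bL : `|beta n| <= ln (n%:R : R) by near: n.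
  have b0 : 0 <= beta n by near: n; move: beta_lim => /cvgryPge; exact.
  have P0 : (0 < P n)%N by case/andP: (K_range n n0 ord0) => h1 h2; exact: leq_trans h2.
  have d2 : d <= 2^-1 by rewrite ge_min lexx.
  have de : d <= e / 18 by rewrite ge_min lexx orbT.
  have y1 : 64 / c0 * ((K n ord0)%:R * 2^-1 ^+ K n ord0) <= d.
    have h1 : 64 / c0 * (K n ord0)%:R <= expR (4^-1 * (K n ord0)%:R) by near: n; exact: near_linear_le_expR.
    have h2 : expR (0 - 4^-1 * (K n ord0)%:R) <= d by near: n; exact: near_expR_le.
    apply: le_trans h2; rewrite mulrA.
    have h3 : 2^-1 ^+ K n ord0 <= expR (- 2^-1 * (K n ord0)%:R) :> R.
      rewrite expRM_natr lerXn2r ?nnegrE ?expR_ge0//.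
      by have := @expR_ge1Dx R (- 2^-1); lra.
    have h4 : 0 <= 64 / c0 * (K n ord0)%:R by rewrite mulr_ge0// divr_ge0// ltW.
    have h5 : 0 <= 2^-1 ^+ K n ord0 :> R by rewrite exprn_ge0.
    apply: le_trans (ler_pM h4 h5 h1 h3) _.
    by rewrite -expRD ler_expR; lra.
  have y2 : 4 * expR (- (A / 64 * ln (n%:R : R))) <= d.
    have : expR (0 - g * ln (n%:R : R)) <= d / 4 by near: n; apply: near_expR_le => //; rewrite divr_gt0.
    by rewrite sub0r -/g; lra.
  have y3 : expR (1 - A * (K n ord0)%:R / 16 / 16) <= d.
    have : expR (1 - A / 16 / 16 * (K n ord0)%:R) <= d.
      by near: n; apply: near_expR_le => //; rewrite !divr_gt0.
    by rewrite (_ : A / 16 / 16 * _ = A * (K n ord0)%:R / 16 / 16)//; ring.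
  have y4 : expR (1 - A * ln (n%:R : R) / 64) <= d.
    have : expR (1 - A / 64 * ln (n%:R : R)) <= d by near: n; apply: near_expR_le => //; rewrite divr_gt0.
    by rewrite mulrAC.
  have y5 : expR (- ln (n%:R : R)) <= d.
    have : expR (0 - 1 * ln (n%:R : R)) <= d by near: n; exact: near_expR_le.
    by rewrite sub0r mul1r.
  have y6 : expR (- (g / 4 * ln (n%:R : R))) <= d.
    have : expR (0 - g / 4 * ln (n%:R : R)) <= d by near: n; apply: near_expR_le => //; rewrite divr_gt0.
    by rewrite sub0r.
  have y7 : expR (1 - 1 * beta n) <= d by near: n; exact: near_expR_le.
  have y8 : expR (- (A / 4 * ln (n%:R : R))) <= d.
    have : expR (0 - A / 4 * ln (n%:R : R)) <= d by near: n; apply: near_expR_le => //; rewrite divr_gt0.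
    by rewrite sub0r.
  apply: le_trans (@one_law_bound R m.+1 n (P n) a (K n) ord0 ord_max c0 a_ge0 a_sum1
    (K_range n n0) _ _ n0 P0 c0_gt0 _ A0 _ _ _ _ _ _ _ _ _ _ _ _ _) _ => //.
  + by move=> i; apply: K_mono.
  + by move=> i; apply: K_mono => //; rewrite leq_ord.
  + by near: n.
  + rewrite nbE//; apply/andP; split; first by lra.
    by have := ler_norm (beta n); lra.
  + have h : (K n ord_max)%:R ^+ 2 <= (P n)%:R :> R by near: n.
    apply: le_trans h; rewrite expr2 ler_wpM2r// ler_nat.
    exact: K_mono.
  + have h : 4 / A / (g / 16) * ln (n%:R : R) <= expR (g * ln (n%:R : R)) by near: n; exact: near_linear_le_expR.
    rewrite [X in _ <= X]mulrC -ler_pdivrMr ?divr_gt0//.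
    by rewrite (_ : _ / A / _ = 4 / A / (g / 16) * ln (n%:R : R))//; ring.
  + have h : 4 / (A * c0) * ln (n%:R : R) <= expR (g * ln (n%:R : R)) by near: n; exact: near_linear_le_expR.
    by rewrite mulrAC.
  + by near: n; apply: near_linear_le_expR => //; rewrite divr_gt0.
  + by rewrite mulrC -ler_pdivrMr//; near: n; exact: Lge.
  + by rewrite mulrC -ler_pdivrMr//; near: n; exact: Kge.
  + exact: le_trans d2.
  + exact: le_trans d2.
  + exact: le_trans d2.
  + exact: le_trans d2.
  + exact: le_trans d2.
  + exact: le_trans d2.
  rewrite nbE// [ln _ + _]addrC addrK; rewrite mul1r in y7; lra.
Unshelve. all: by end_near. Qed.
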